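(* Let $n\ge 2$. For each $k=1,\dots,n-1$ let $\{i_k,i_k'\}$ be a pair of integers with $i_k\in\{0,1,\dots,k\}$, $i_k'\in\{1,\dots,k+1\}$, $i_k<i_k'$, and fix a top row of integers $l_{n1}>l_{n2}>\cdots>l_{nn}$. Then the Gelfand-Tsetlin formulas define a $\mathfrak{gl}_n$-module structure on the Gelfand-Graev continuation $H\{i_k,i_k'\}$ (with this top row) if and only if the LP-condition holds, i.e. for each $k=2,3,\dots,n-1$, $$i_{k-1},\ i_{k-1}'\in\{0,\ i_k,\ i_k'-1,\ k\}.$$
   Context: The ground field is $\mathbb{C}$; $E_{ij}$ are the elementary matrices of $\mathfrak{gl}_n=\mathfrak{gl}_n(\mathbb{C})$. A tableau $T(L)$ of height $n$ is a triangular array with entries $L=(l_{ij})_{1\le j\le i\le n}$, the $i$-th row being $(l_{i1},\dots,l_{ii})$; row $n$ is the top row. $\boldsymbol{\delta}^{ij}$ is the array with $1$ in position $(i,j)$ and $0$ elsewhere. Gelfand-Graev continuation: $H\{i_k,i_k'\}$ is the space having as (orthonormal) basis the set $\mathcal{B}$ of all tableaux $T(L)$ with integer entries, with the fixed top row, satisfying the GG-condition, i.e. the inequalities - $l_{k,j}>l_{k,j+1}$ for $j<k\le n$; - and, for every $1\le k\le n-1$ and $1\le j\le k$: $l_{k+1,j-1}\ge l_{kj}>l_{k+1,j}$ if $j\le i_k$; $l_{k+1,j}\ge l_{kj}>l_{k+1,j+1}$ if $i_k<j<i_k'$; $l_{k+1,j+1}\ge l_{kj}>l_{k+1,j+2}$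 if $j\ge i_k'$. An inequality involving an entry $l_{k+1,0}$ or $l_{k+1,k+2}$ (which does not exist) is omitted. Only the vector space with basis $\mathcal{B}$ matters for the module structure. Gelfand-Tsetlin formulas on $\mathcal B$: $$E_{k,k+1}T(L)=-\sum_{i=1}^{k}\frac{\prod_{j=1}^{k+1}(l_{ki}-l_{k+1,j})}{\prod_{j\ne i,\,1\le j\le k}(l_{ki}-l_{kj})}T(L+\boldsymbol{\delta}^{ki}),$$ $$E_{k+1,k}T(L)=\sum_{i=1}^{k}\frac{\prod_{j=1}^{k-1}(l_{ki}-l_{k-1,j})}{\prod_{j\ne i,\,1\le j\le k}(l_{ki}-l_{kj})}T(L-\boldsymbol{\delta}^{ki}),$$ $$E_{kk}T(L)=\Big(k-1+\sum_{i=1}^{k}l_{ki}-\sum_{i=1}^{k-1}l_{k-1,i}\Big)T(L),$$ where a summand is zero by definition if the tableau $T(L\pm\boldsymbol{\delta}^{ki})$ is not in $\mathcal{B}$. ''Define a $\mathfrak{gl}_n$-module structure'' means that these operators, prescribed on the generators $E_{k,k+1},E_{k+1,k}$ $(1\le k\le n-1)$ and $E_{kk}$ $(1\le k\le n)$ of $\mathfrak{gl}_n$, extend to a representation of $\mathfrak{gl}_n$. *)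

(* Defs.v *)
From mathcomp Require Import all_boot all_order all_algebra.
From mathcomp Require Import reals complex.
From mathcomp Require Import monalg.

Set Implicit Arguments.
Unset Strict Implicit.
Unset Printing Implicit Defensive.

Import Order.TTheory GRing.Theory Num.Theory.
Local Open Scope ring_scope.

(* Representations of gl_n(F) on V, where gl_n(F) is 'M[F]_n with the          *)
(* commutator bracket.                                                        *)
Definition gl_rep (F : fieldType) (n : nat) (V : lmodType F)
    (rho : 'M[F]_n -> V -> V) : Prop :=
  [/\ forall X : 'M[F]_n, linear (rho X),
      forall v : V, linear (fun X => rho X v)
    & forall (X Y : 'M[F]_n) (v : V),
        rho (X *m Y - Y *m X) v = rho X (rho Y v) - rho Y (rho X v)].

(* Row a.+1 of the triangular array is indexed by 'I_a.+1, for a : 'I_n.  All  *)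
(* later definitions go through [entry] and [shift], which use the indices     *)
(* 1 <= j <= i <= n of the mathematical text.                                 *)
Definition tableau (n : nat) := {ffun {a : 'I_n & 'I_a.+1} -> int}.

Definition at_pos (n : nat) (i j : nat) (p : {a : 'I_n & 'I_a.+1}) : bool :=
  ((tag p).+1 == i) && ((tagged p).+1 == j).

(* The entry l_ij; the value is 0 when (i, j) is not a position of the array.  *)
Definition entry (n : nat) (L : tableau n) (i j : nat) : int :=
  if [pick p | at_pos i j p] is Some p then L p else 0.

(* L + c * delta^{ij}. *)
Definition shift (n : nat) (L : tableau n) (i j : nat) (c : int) : tableau n :=
  [ffun p => L p + (if at_pos i j p then c else 0)].

Section GelfandGraev.

Variables (n : nat) (i i' : nat -> nat) (top : nat -> int).

(* The guards 1 < j and j < k drop the inequalities that would involve the     *)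
(* nonexistent entries l_{k+1,0} and l_{k+1,k+2}.                             *)
Definition GG_between (L : tableau n) (k j : nat) : bool :=
  let l := entry L in
  [&& (j <= i k)%N ==>
        ((1 < j)%N ==> (l k j <= l k.+1 j.-1)) && (l k.+1 j < l k j),
      (i k < j < i' k)%N ==>
        (l k j <= l k.+1 j) && (l k.+1 j.+1 < l k j)
    & (i' k <= j)%N ==>
        (l k j <= l k.+1 j.+1) && ((j < k)%N ==> (l k.+1 j.+2 < l k j))].

Definition GG_condition (L : tableau n) : bool :=
  [forall k : 'I_n.+1, forall j : 'I_n.+1,
     (1 <= j < k)%N ==> (entry L k j.+1 < entry L k j)]
  && [forall k : 'I_n, forall j : 'I_n,
        (1 <= j <= k)%N ==> GG_between L k j].

Definition has_top_row (L : tableau n) : bool :=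
  [forall j : 'I_n, entry L n j.+1 == top j.+1].

Definition GG_basis := {L : tableau n | has_top_row L && GG_condition L}.

Variable F : fieldType.

Definition GG_space : lmodType F := {malg F[GG_basis]}.

(* The vector T(L), taken to be zero when T(L) is not in the basis. *)
Definition T (L : tableau n) : GG_space :=
  if insub L is Some b then << (b : GG_basis) >> else 0.

Definition GT_raise (k : nat) (L : tableau n) : GG_space :=
  let l a b : F := (entry L a b)%:~R in
  - \sum_(1 <= m < k.+1)
      ((\prod_(1 <= j < k.+2) (l k m - l k.+1 j))
       / (\prod_(1 <= j < k.+1 | j != m) (l k m - l k j)))
      *: T (shift L k m 1).

Definition GT_lower (k : nat) (L : tableau n) : GG_space :=
  let l a b : F := (entry L a b)%:~R in
  \sum_(1 <= m < k.+1)
      ((\prod_(1 <= j < k) (l k m - l k.-1 j))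
       / (\prod_(1 <= j < k.+1 | j != m) (l k m - l k j)))
      *: T (shift L k m (-1)).

Definition GT_diag (k : nat) (L : tableau n) : GG_space :=
  let l a b : F := (entry L a b)%:~R in
  (k.-1%:R + \sum_(1 <= m < k.+1) l k m - \sum_(1 <= m < k) l k.-1 m) *: T L.

(* In 'I_n the elementary matrix E_{k,k+1} is delta_mx a b with a = k - 1 and  *)
(* b = k.                                                                     *)
Definition GT_module : Prop :=
  exists2 rho : 'M[F]_n -> GG_space -> GG_space, gl_rep rho &
    forall b : GG_basis,
      [/\ forall a1 a2 : 'I_n, a2 = a1.+1 :> nat ->
            rho (delta_mx a1 a2) << b >> = GT_raise a1.+1 (val b),
          forall a1 a2 : 'I_n, a2 = a1.+1 :> nat ->
            rho (delta_mx a2 a1) << b >> = GT_lower a1.+1 (val b)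
        & forall a : 'I_n,
            rho (delta_mx a a) << b >> = GT_diag a.+1 (val b)].

Definition LP_condition : Prop :=
  forall k : nat, (2 <= k < n)%N ->
    i k.-1 \in [:: 0%N; i k; (i' k).-1; k] /\
    i' k.-1 \in [:: 0%N; i k; (i' k).-1; k].

End GelfandGraev.

(* Main.v *)
Require Import Defs.
From mathcomp Require Import all_boot all_order all_algebra.
From mathcomp Require Import reals complex boolp functions.
From mathcomp Require Import finmap monalg.
From mathcomp Require Import zify ring.

Set Implicit Arguments.
Unset Strict Implicit.
Unset Printing Implicit Defensive.
Import Order.TTheory GRing.Theory Num.Theory.
Local Open Scope ring_scope.

(* The GG-condition says that each entry of row k lies in a prescribed one of  *)
(* the k + 2 intervals cut out by row k + 1, the intervals i_k and i'_k being  *)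
(* left empty.  A monomial in the E_{k,k+1}, E_{k+1,k} acts on T(L) by a sum   *)
(* over paths of unit moves.  A path that leaves the set of GG-tableaux and    *)
(* comes back has coefficient zero, so truncation may be ignored, and all the  *)
(* Serre relations reduce to rational identities.  Those identities can fail   *)
(* only when two entries of row k are adjacent integers x_j = x_{j+1} + 1;     *)
(* then x_{j+1} occurs in row k + 1, and the LP-condition makes x_j occur in   *)
(* row k - 1, which excludes the bad cases.  For [E_{k,k+1}, E_{k+1,k}] the    *)
(* diagonal coefficient is a sum of residues of a rational function, and the   *)
(* defect is the sum of its residues at the x_{j+1} with x_j = x_{j+1} + 1.    *)
(* Conversely, if LP fails at an empty interval g of row k - 1, then there is  *)
(* a GG-tableau with x_g = x_{g+1} + 1 and x_g not in row k - 1, which has a   *)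
(* nonzero residue.  If the other empty interval also contributes, the defect  *)
(* is affine in the leftmost entry of row k - 1, which can be moved freely.    *)
(* The elements E_ij of gl_n are obtained from the generators as iterated      *)
(* brackets, whose relations follow from the Serre relations by induction.     *)

(** * From the Serre relations to the relations of gl_n *)

(** Write y, x, z for rows k+1, k, k-1. By [GG_basisP] the basis consists of the tableaux in which
    each x_j lies in the interval of y numbered [slot k j]. A unit move turning x <= y into x > y
    has coefficient 0 ([coef_cross]), so products of generators can be computed with untruncated
    path coefficients ([op_word_step_op]).

    The place where LP enters is an adjacent pair x_j = x_{j+1} + 1. Such a pair forces 1 <= j < k
    and j different from i_k and i'_k - 1 ([adjacent_upper]), and x_j then occurs in z unless j is
    one of the intervals i_{k-1}, i'_{k-1} that row k-1 leaves empty ([adjacent_lower]). LP says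
    exactly that this exception never arises.

    If x_j always occurs in z, then in the Serre relations no adjacent pair can be shifted as a
    whole ([adjacent_shift]), and the rational identities [serre_coef_partner] and
    [serre_coef_other] apply. In [E_{k,k+1}, E_{k+1,k}] the defect is a sum of residues at t =
    x_{j+1} ([sum_terms_reduced_residue]), and each contains the factor prod_z (t + 1 - z), which
    vanishes at z = x_j ([double_residues_LP]). The Serre relations yield all of gl_n by
    [gl_relations_elem_vec].

    If LP fails at g, a tableau with an adjacent pair at g has a nonzero residue there, and
    [adjacent_residues_contra] shows that the defect cannot vanish for the whole family
    [adjacent_tableau]. *)

Record lie_bracket (A : zmodType) (br : A -> A -> A) : Prop := LieBracket {
  brDl : forall x y z, br (x + y) z = br x z + br y z;
  brC : forall x y, br x y = - br y x;
  br_jacobi : forall x y z, br x (br y z) = br (br x y) z + br y (br x z) }.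

(** Numbering starts at 0: [e k] and [f k] stand for E_{k+1,k+2} and E_{k+2,k+1} of the mathematical
    text. The rule [x, x] = 0 comes from antisymmetry and the absence of 2-torsion ([tf2] below). *)
Record serre_relations (A : zmodType) (br : A -> A -> A) (n : nat)
    (e f h : nat -> A) : Prop := SerreRelations {
  serre_hh : forall i j, (i < n)%N -> (j < n)%N -> br (h i) (h j) = 0;
  serre_he : forall i k, (i < n)%N -> (k.+1 < n)%N ->
    br (h i) (e k) = e k *+ (i == k) - e k *+ (i == k.+1);
  serre_hf : forall i k, (i < n)%N -> (k.+1 < n)%N ->
    br (h i) (f k) = f k *+ (i == k.+1) - f k *+ (i == k);
  serre_ef : forall k l, (k.+1 < n)%N -> (l.+1 < n)%N ->
    br (e k) (f l) = (h k - h k.+1) *+ (k == l);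
  serre_ee0 : forall k l, (l.+1 < n)%N -> (k.+1 < l)%N -> br (e k) (e l) = 0;
  serre_ff0 : forall k l, (l.+1 < n)%N -> (k.+1 < l)%N -> br (f k) (f l) = 0;
  serre_ee : forall k, (k.+2 < n)%N -> br (e k) (br (e k) (e k.+1)) = 0;
  serre_ee' : forall k, (k.+2 < n)%N -> br (e k.+1) (br (e k.+1) (e k)) = 0;
  serre_ff : forall k, (k.+2 < n)%N -> br (f k) (br (f k) (f k.+1)) = 0;
  serre_ff' : forall k, (k.+2 < n)%N -> br (f k.+1) (br (f k.+1) (f k)) = 0 }.

Section LieRing.
Variables (A : zmodType) (br : A -> A -> A).
Hypothesis brP : lie_bracket br.
Implicit Types x y z : A.

Lemma brDr x y z : br x (y + z) = br x y + br x z.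
Proof. by rewrite (brC brP) (brDl brP) opprD -!(brC brP). Qed.

Lemma br0l x : br 0 x = 0.
Proof. by apply: (addrI (br 0 x)); rewrite -(brDl brP) !addr0. Qed.

Lemma br0r x : br x 0 = 0.
Proof. by rewrite (brC brP) br0l oppr0. Qed.

Lemma brNl x y : br (- x) y = - br x y.
Proof. by apply/eqP; rewrite -addr_eq0 -(brDl brP) addNr br0l. Qed.

Lemma brNr x y : br x (- y) = - br x y.
Proof. by apply/eqP; rewrite -addr_eq0 -brDr addNr br0r. Qed.

Lemma brBl x y z : br (x - y) z = br x z - br y z.
Proof. by rewrite (brDl brP) brNl. Qed.

Lemma brBr x y z : br x (y - z) = br x y - br x z.
Proof. by rewrite brDr brNr. Qed.

Lemma brMnl x y k : br (x *+ k) y = br x y *+ k.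
Proof. by elim: k => [|k IH]; rewrite ?mulr0n ?br0l // !mulrS (brDl brP) IH. Qed.

Lemma brMnr x y k : br x (y *+ k) = br x y *+ k.
Proof. by elim: k => [|k IH]; rewrite ?mulr0n ?br0r // !mulrS brDr IH. Qed.

Lemma br_eq0C x y : br x y = 0 -> br y x = 0.
Proof. by rewrite (brC brP) => /eqP; rewrite oppr_eq0 => /eqP. Qed.

Lemma jacobi_r x y z : br (br x y) z = br x (br y z) - br y (br x z).
Proof. by rewrite (br_jacobi brP) addrK. Qed.

(* Transposition exchanges the two triangular halves, so that every relation  *)
(* has to be proved for one half only.                                        *)
Lemma lie_bracket_op : lie_bracket (fun x y => br y x).
Proof.
split=> [x y z|x y|x y z]; first exact: brDr.
  exact: brC.
by rewrite (jacobi_r z y x) -(brC brP).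
Qed.

Lemma serre_relations_op n e f h :
  serre_relations br n e f h ->
  serre_relations (fun x y => br y x) n f e h.
Proof.
move=> S; split=> [i j lti ltj|i k lti ltk|i k lti ltk|k l ltk ltl|k l ltl ltkl
  |k l ltl ltkl|k ltk|k ltk|k ltk|k ltk].
- exact: (serre_hh S).
- by rewrite (brC brP) (serre_hf S) // opprB.
- by rewrite (brC brP) (serre_he S) // opprB.
- by rewrite (serre_ef S) //; case: eqVneq => [->|]; rewrite ?eqxx // eq_sym => /negbTE->.
- exact: br_eq0C (serre_ff0 S ltl ltkl).
- exact: br_eq0C (serre_ee0 S ltl ltkl).
- by rewrite (brC brP) (brC brP (f k.+1)) brNr opprK (serre_ff S).
- by rewrite (brC brP) (brC brP (f k)) brNr opprK (serre_ff' S).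
- by rewrite (brC brP) (brC brP (e k.+1)) brNr opprK (serre_ee S).
- by rewrite (brC brP) (brC brP (e k)) brNr opprK (serre_ee' S).
Qed.
End LieRing.

Section RootVectors.
Variables (A : zmodType) (br : A -> A -> A) (e f h : nat -> A).

(** This is E_{i,i+d}. Starting from [h i] includes the diagonal, and d = 1 gives [h_i, e_i] =
    e_i. *)
Fixpoint upper_vec (i d : nat) : A :=
  if d is d'.+1 then br (upper_vec i d') (e (i + d')) else h i.

Fixpoint lower_vec (i d : nat) : A :=
  if d is d'.+1 then br (f (i + d')) (lower_vec i d') else h i.

Definition elem_vec (i j : nat) : A :=
  if (i <= j)%N then upper_vec i (j - i) else lower_vec j (i - j).

End RootVectors.

Lemma upper_vec_op (A : zmodType) (br : A -> A -> A) f h i d :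
  upper_vec (fun x y => br y x) f h i d = lower_vec br f h i d.
Proof. by elim: d => //= d ->. Qed.

Lemma lower_vec_op (A : zmodType) (br : A -> A -> A) e h i d :
  lower_vec (fun x y => br y x) e h i d = upper_vec br e h i d.
Proof. by elim: d => //= d ->. Qed.

Lemma elem_vec_op (A : zmodType) (br : A -> A -> A) e f h i j :
  elem_vec (fun x y => br y x) f e h i j = elem_vec br e f h j i.
Proof.
rewrite /elem_vec upper_vec_op lower_vec_op.
by case: (ltngtP i j) => // ->; rewrite !subnn.
Qed.

(** The induction parameter [m] is the size of the top left block in which the relations are
    known. *)
Definition gl_relations (A : zmodType) (br : A -> A -> A) (E : nat -> nat -> A)
    (m : nat) : Prop :=
  forall i j k l, (i < m)%N -> (j < m)%N -> (k < m)%N -> (l < m)%N ->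
    br (E i j) (E k l) = E i l *+ (j == k) - E k j *+ (i == l).

Lemma gl_relations_op (A : zmodType) (br : A -> A -> A) E m :
  gl_relations br E m ->
  gl_relations (fun x y => br y x) (fun i j => E j i) m.
Proof.
by move=> P i j k l lti ltj ltk ltl; rewrite P // (eq_sym k) (eq_sym l).
Qed.

Section ElemVec.
Variables (A : zmodType) (br : A -> A -> A) (e f h : nat -> A).
Local Notation E := (elem_vec br e f h).

Lemma elem_vec_diag i : E i i = h i.
Proof. by rewrite /elem_vec leqnn subnn. Qed.

Lemma elem_vecS i q : (i <= q)%N -> E i q.+1 = br (E i q) (e q).
Proof.
by move=> le_iq; rewrite /elem_vec (leqW le_iq) le_iq subSn //= subnKC.
Qed.

End ElemVec.

Section UpperHalf.
Variables (A : zmodType) (br : A -> A -> A) (n : nat) (e f h : nat -> A).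
Hypotheses (brP : lie_bracket br) (S : serre_relations br n e f h).
Hypothesis tf2 : forall x : A, x *+ 2 = 0 -> x = 0.
Local Notation E := (elem_vec br e f h).
Variable q : nat.
Hypotheses (q_lt : (q.+1 < n)%N) (Pq : gl_relations br E q.+1).

(** [E i j] is an iterated bracket of some h_a with a < q and of e_a with a + 1 < q or f_a with a <
    q, and all of these commute with e_q. *)
Lemma elem_vec_comm_raise i j : (i <= q)%N -> (j < q)%N -> br (E i j) (e q) = 0.
Proof.
move=> le_iq lt_jq; rewrite /elem_vec; case: leqP => [le_ij|lt_ji].
  rewrite -(subnKC le_ij) in lt_jq; move: lt_jq.
  elim: (j - i)%N => [|d IH] /= lt_q.
    by rewrite (serre_he S) ?ltn_eqF ?subrr //; lia.
  rewrite (jacobi_r brP) (serre_ee0 S) ?IH ?(br0r brP) ?subrr //; lia.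
rewrite -(subnKC (ltnW lt_ji)) in le_iq; move: le_iq.
elim: (i - j)%N => [|d IH] /= le_q.
  by rewrite (serre_he S) ?ltn_eqF ?subrr //; lia.
rewrite (jacobi_r brP) IH; last lia.
rewrite (br_eq0C brP (x := e q)) ?(br0r brP) ?subrr //.
rewrite (serre_ef S) ?gtn_eqF //; lia.
Qed.

(** The Serre relation [e_{q-1}, [e_{q-1}, e_q]] = 0 spreads to all of column q by applying ad
    E_{i,q-1} and ad E_{k,q-1}. *)
Lemma br_raise_raise i k :
  (i < q)%N -> (k < q)%N -> br (E i q) (br (E k q) (e q)) = 0.
Proof.
case: q q_lt Pq elem_vec_comm_raise => // p p_lt Pp comm lt_i lt_k.
have Ep : E p p.+1 = br (h p) (e p) by rewrite elem_vecS ?elem_vec_diag.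
have {}Ep : E p p.+1 = e p.
  by rewrite Ep (serre_he S) ?eqxx ?[(p == p.+1)]ltn_eqF ?subr0 //; lia.
have sE : br (E p p.+1) (br (E p p.+1) (e p.+1)) = 0 by rewrite Ep (serre_ee S).
have s1 i0 : (i0 < p)%N -> br (E i0 p.+1) (br (E p p.+1) (e p.+1)) = 0.
  move=> lt0.
  have EE : br (E i0 p) (E p p.+1) = E i0 p.+1.
    by rewrite Pp ?eqxx ?(ltn_eqF (_ : i0 < p.+1))%N ?subr0 //; lia.
  have c0 : br (E i0 p.+1) (E p p.+1) = 0.
    by rewrite Pp ?(gtn_eqF (_ : p < p.+1))%N ?(ltn_eqF (_ : i0 < p.+1))%N ?subrr //; lia.
  have ce : br (E i0 p) (e p.+1) = 0 by rewrite comm //; lia.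
  (* The Jacobi identity gives two terms that coincide, so the bracket appears doubled. *)
  have /(congr1 (br (E i0 p))) := sE.
  rewrite (br0r brP) (br_jacobi brP) EE (br_jacobi brP (E i0 p)) EE ce.
  rewrite (br0r brP) addr0 (br_jacobi brP (E p p.+1)) (br_eq0C brP c0).
  by rewrite (br0l brP) add0r => /tf2.
have s2 i0 k0 : (i0 < p)%N -> (k0 < p)%N -> br (E i0 p.+1) (br (E k0 p.+1) (e p.+1)) = 0.
  move=> lti0 ltk0.
  have EE : br (E k0 p) (E p p.+1) = E k0 p.+1.
    by rewrite Pp ?eqxx ?(ltn_eqF (_ : k0 < p.+1))%N ?subr0 //; lia.
  have c0 : br (E k0 p) (E i0 p.+1) = 0.
    by rewrite Pp ?(gtn_eqF (_ : i0 < p))%N ?(ltn_eqF (_ : k0 < p.+1))%N ?subrr //; lia.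
  have ce : br (E k0 p) (e p.+1) = 0 by rewrite comm //; lia.
  have /(congr1 (br (E k0 p))) := s1 _ lti0.
  rewrite (br0r brP) (br_jacobi brP) c0 (br0l brP) add0r.
  by rewrite (br_jacobi brP (E k0 p)) EE ce (br0r brP) addr0.
move: lt_i; rewrite ltnS leq_eqVlt => /predU1P[->|lt_i].
  move: lt_k; rewrite ltnS leq_eqVlt => /predU1P[->|lt_k] //.
  have c0 : br (E p p.+1) (E k p.+1) = 0.
    by rewrite Pp ?(gtn_eqF (_ : k < p.+1))%N ?(ltn_eqF (_ : p < p.+1))%N ?subrr //; lia.
  by rewrite (br_jacobi brP) c0 (br0l brP) add0r s1.
move: lt_k; rewrite ltnS leq_eqVlt => /predU1P[->|lt_k]; first exact: s1.
exact: s2.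
Qed.

Lemma elem_vec_br_last_col i j k : (i <= q)%N -> (j <= q)%N -> (k <= q)%N ->
  br (E i j) (E k q.+1) = E i q.+1 *+ (j == k).
Proof.
move=> lei lej lek; rewrite !elem_vecS //.
have [lt_jq|] := ltnP j q.
  rewrite (br_jacobi brP) elem_vec_comm_raise // (br0r brP) addr0 Pq //.
  rewrite (brBl brP) !(brMnl brP) (elem_vec_comm_raise lek lt_jq).
  by rewrite mul0rn subr0.
move=> leqj; have {lej leqj}-> : j = q by apply/eqP; rewrite eqn_leq lej.
have hq : br (E q q) (e q) = e q.
  by rewrite elem_vec_diag (serre_he S) ?eqxx ?ltn_eqF ?subr0 //; lia.
have [lt_kq|] := ltnP k q; last first.
  move=> leqk; have {lek leqk}-> : k = q by apply/eqP; rewrite eqn_leq lek.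
  by rewrite hq eqxx.
rewrite (gtn_eqF lt_kq) mulr0n.
have [lt_iq|] := ltnP i q; first exact: br_raise_raise.
move=> leqi; have {lei leqi}-> : i = q by apply/eqP; rewrite eqn_leq lei.
rewrite (br_jacobi brP) hq Pq ?eqxx ?(gtn_eqF lt_kq) //.
by rewrite mulr0n sub0r (brNl brP) addNr.
Qed.

(** For k < q this is the Serre relation [e_q, [e_q, e_{q-1}]] = 0, moved to row k by ad
    E_{k,q-1}. *)
Lemma raise_br_last_col k : (k <= q)%N -> br (e q) (E k q.+1) = 0.
Proof.
have hq : br (E q q) (e q) = e q.
  by rewrite elem_vec_diag (serre_he S) ?eqxx ?ltn_eqF ?subr0 //; lia.
have qq : br (e q) (e q) = 0.
  by apply: tf2; rewrite mulr2n {2}(brC brP) subrr.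
move=> le_kq; rewrite elem_vecS //.
have [lt_kq|] := ltnP k q; last first.
  move=> leqk; have {le_kq leqk}-> : k = q by apply/eqP; rewrite eqn_leq le_kq.
  by rewrite hq.
case: q q_lt Pq lt_kq qq elem_vec_comm_raise => // p p_lt Pp lt_k qq comm.
have Ep : E p p.+1 = br (h p) (e p) by rewrite elem_vecS ?elem_vec_diag.
have {}Ep : E p p.+1 = e p.
  by rewrite Ep (serre_he S) ?eqxx ?[(p == p.+1)]ltn_eqF ?subr0 //; lia.
have sE : br (e p.+1) (br (E p p.+1) (e p.+1)) = 0.
  by rewrite Ep (brC brP (e p)) (brNr brP) (serre_ee' S) ?oppr0.
move: lt_k; rewrite ltnS leq_eqVlt => /predU1P[->|lt_k] //.
have EE : br (E k p) (E p p.+1) = E k p.+1.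
  by rewrite Pp ?eqxx ?(ltn_eqF (_ : k < p.+1))%N ?subr0 //; lia.
have ce : br (E k p) (e p.+1) = 0 by rewrite comm //; lia.
have /(congr1 (br (E k p))) := sE.
rewrite (br0r brP) (br_jacobi brP) ce (br0l brP) add0r.
by rewrite (br_jacobi brP (E k p)) EE ce (br0r brP) addr0.
Qed.

Lemma last_col_br_last_col i k : (i <= q)%N -> (k <= q)%N ->
  br (E i q.+1) (E k q.+1) = 0.
Proof.
move=> lei lek; rewrite {1}elem_vecS // (jacobi_r brP) raise_br_last_col //.
by rewrite (br0r brP) sub0r elem_vec_br_last_col // (brMnr brP)
  raise_br_last_col // mul0rn oppr0.
Qed.

Lemma last_diag_br_upper i j : (i <= j <= q)%N -> br (h q.+1) (E i j) = 0.
Proof.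
case/andP=> le_ij le_jq; rewrite /elem_vec le_ij.
have: (i + (j - i) <= q)%N by rewrite subnKC.
elim: (j - i)%N => [|d IH] /= le_q; first by rewrite (serre_hh S) //; lia.
rewrite (br_jacobi brP) IH ?(br0l brP) ?add0r; last lia.
by rewrite (serre_he S) ?gtn_eqF ?subrr ?(br0r brP) //; lia.
Qed.

Lemma last_diag_br_last_col k : (k <= q)%N ->
  br (h q.+1) (E k q.+1) = - E k q.+1.
Proof.
have hq : br (h q.+1) (e q) = - e q.
  by rewrite (serre_he S) ?eqxx ?gtn_eqF ?sub0r //; lia.
move=> lek; rewrite elem_vecS // (br_jacobi brP) hq (brNr brP).
by rewrite last_diag_br_upper ?lek ?leqnn // (br0l brP) add0r.
Qed.

End UpperHalf.

Section BothHalves.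
Variables (A : zmodType) (br : A -> A -> A) (n : nat) (e f h : nat -> A).
Hypotheses (brP : lie_bracket br) (S : serre_relations br n e f h).
Hypothesis tf2 : forall x : A, x *+ 2 = 0 -> x = 0.
Local Notation E := (elem_vec br e f h).

Section Step.
Variable q : nat.
Hypotheses (q_lt : (q.+1 < n)%N) (Pq : gl_relations br E q.+1).

Let brP' := lie_bracket_op brP.
Let S' := serre_relations_op brP S.
Let EE' := elem_vec_op br e f h.

Let Pq' : gl_relations (fun x y => br y x)
  (elem_vec (fun x y => br y x) f e h) q.+1.
Proof.
move=> i j k l lti ltj ltk ltl; rewrite !EE'.
exact: (gl_relations_op Pq).
Qed.

Lemma elem_vec_br_last_row i j k : (i <= q)%N -> (j <= q)%N -> (k <= q)%N ->
  br (E i j) (E q.+1 k) = - (E q.+1 j *+ (i == k)).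
Proof.
move=> lei lej lek; rewrite (brC brP).
by have := elem_vec_br_last_col brP' S' tf2 q_lt Pq' lej lei lek; rewrite !EE' => ->.
Qed.

Lemma last_row_br_last_row i k : (i <= q)%N -> (k <= q)%N ->
  br (E q.+1 i) (E q.+1 k) = 0.
Proof.
move=> lei lek.
by have := last_col_br_last_col brP' S' tf2 q_lt Pq' lek lei; rewrite !EE' => ->.
Qed.

Lemma last_diag_br_last_row k : (k <= q)%N ->
  br (h q.+1) (E q.+1 k) = E q.+1 k.
Proof.
move=> lek; rewrite (brC brP).
by have := last_diag_br_last_col brP' S' q_lt lek; rewrite !EE' => ->; rewrite opprK.
Qed.

Lemma last_diag_br i j : (i <= q)%N -> (j <= q)%N -> br (h q.+1) (E i j) = 0.
Proof.
move=> lei lej; case: (leqP i j) => ij.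
  by rewrite (last_diag_br_upper brP S q_lt) ?ij.
rewrite (brC brP).
have := last_diag_br_upper brP' S' q_lt (i := j) (j := i).
by rewrite !EE' (ltnW ij) => ->; rewrite ?oppr0.
Qed.

Lemma raise_br_last_row k : (k <= q)%N ->
  br (e q) (E q.+1 k) = E q k - h q.+1 *+ (q == k).
Proof.
move=> lek.
have hq : br (f q) (h q) = f q.
  by rewrite (brC brP) (serre_hf S) ?eqxx ?ltn_eqF ?sub0r ?opprK //; lia.
have ER : E q.+1 k = br (f q) (E q k).
  by have := elem_vecS (fun x y => br y x) f e h lek; rewrite !EE'.
rewrite ER (br_jacobi brP) (serre_ef S) // eqxx mulr1n.
have [lt_kq|] := ltnP k q; last first.
  move=> leqk; have {lek leqk ER}-> : k = q by apply/eqP; rewrite eqn_leq lek.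
  rewrite eqxx elem_vec_diag (brC brP (e q)) (serre_he S) ?eqxx
    ?(ltn_eqF (_ : q < q.+1))%N //; last lia.
  rewrite subr0 (brNr brP) (brC brP (f q)) opprK (serre_ef S) // eqxx.
  by rewrite (brBl brP) !(serre_hh S) ?subrr ?add0r //; lia.
rewrite (gtn_eqF lt_kq) subr0.
rewrite (br_eq0C brP (elem_vec_comm_raise brP S q_lt _ _)) // (br0r brP) addr0.
rewrite (brBl brP) last_diag_br // subr0 -(elem_vec_diag br e f h q).
by rewrite Pq ?eqxx ?(gtn_eqF lt_kq) ?subr0 // ltnW.
Qed.

(** The relation mixing the new column with the new row. Expanding E_{i,q+1} = [E_{i,q}, e_q]
    reduces it to [raise_br_last_row]. *)
Lemma last_col_br_last_row i k : (i <= q)%N -> (k <= q)%N ->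
  br (E i q.+1) (E q.+1 k) = E i k - h q.+1 *+ (i == k).
Proof.
move=> lei lek.
have hq : br (E q q) (e q) = e q.
  by rewrite elem_vec_diag (serre_he S) ?eqxx ?ltn_eqF ?subr0 //; lia.
have [lt_iq|] := ltnP i q; last first.
  move=> leqi; have {lei leqi}-> : i = q by apply/eqP; rewrite eqn_leq lei.
  by rewrite elem_vecS // hq raise_br_last_row.
rewrite elem_vecS // (jacobi_r brP) raise_br_last_row //.
rewrite elem_vec_br_last_row // (brBr brP) (brMnr brP) (brC brP _ (h _)).
rewrite last_diag_br // oppr0 mul0rn subr0 Pq // eqxx.
rewrite (brNr brP) opprK (brMnr brP) raise_br_last_row // eqxx.
rewrite elem_vec_diag mulr1n mulrnBl addrA subrK.
by case: eqP => // <-.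
Qed.

Lemma gl_relationsS : gl_relations br E q.+2.
Proof.
have tr := elem_vec_br_last_col brP S tf2 q_lt Pq.
have hR := last_diag_br_last_col brP S q_lt.
have hE : br (h q.+1) (h q.+1) = 0 by rewrite (serre_hh S).
have nq (x : nat) : (x <= q)%N ->
    ((x == q.+1) = false) * ((q.+1 == x) = false).
  by move=> lex; rewrite eq_sym gtn_eqF.
have lt2 (x : nat) : (x < q.+2)%N -> x = q.+1 \/ (x <= q)%N.
  by rewrite ltnS leq_eqVlt => /predU1P.
(* Sixteen cases: each index is either q + 1 or at most q. *)
move=> i j k l /lt2[->|lei] /lt2[->|lej] /lt2[->|lek] /lt2[->|lel];
rewrite ?eqxx ?(elem_vec_diag br e f h q.+1) ?mulr1n;
rewrite ?(nq _ lei) ?(nq _ lej) ?(nq _ lek) ?(nq _ lel) ?mulr0n ?subr0 ?sub0r.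
- by rewrite subrr.
- exact: last_diag_br_last_row.
- exact: hR.
- exact: last_diag_br.
- by rewrite (brC brP) last_diag_br_last_row.
- exact: last_row_br_last_row.
- by rewrite (brC brP) last_col_br_last_row // opprB eq_sym.
- by rewrite (brC brP) elem_vec_br_last_row // opprK eq_sym.
- by rewrite (brC brP) hR // opprK.
- by rewrite last_col_br_last_row.
- exact: (last_col_br_last_col brP S tf2 q_lt Pq).
- by rewrite (brC brP) tr // eq_sym.
- by rewrite (brC brP) last_diag_br // oppr0.
- exact: elem_vec_br_last_row.
- exact: tr.
- exact: Pq.
Qed.
End Step.

Lemma gl_relations_elem_vec : (0 < n)%N -> gl_relations br E n.
Proof.
move=> n_gt0; suff P q : (q < n)%N -> gl_relations br E q.+1.
  by rewrite -(prednK n_gt0); apply: P; rewrite prednK.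
elim: q => [_|q IH q_lt]; last by apply: gl_relationsS (IH _) => //; exact: ltnW.
move=> i j k l; rewrite !ltnS !leqn0 => /eqP-> /eqP-> /eqP-> /eqP->.
by rewrite elem_vec_diag (serre_hh S) // eqxx subrr.
Qed.

End BothHalves.

(** * Residues *)

Section PartialFractions.
Variable F : fieldType.
Implicit Types (A B : seq F) (q : {poly F}).

Lemma prod_neq0_seq B (P : pred F) (t : F) :
  (forall b, b \in B -> P b -> b != t) -> \prod_(b <- B | P b) (t - b) != 0.
Proof.
move=> H; rewrite big_seq_cond; elim/big_rec: _ => [|b x /andP[bB Pb] x0].
  exact: oner_neq0.
by rewrite mulf_neq0 // subr_eq0 eq_sym H.
Qed.

(** Compare coefficients of degree |B| - 1 in the Lagrange interpolation formula at the points of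
    [B], whose basis products are monic of that degree. *)
Lemma lagrange_coef B q : uniq B -> (size q <= size B)%N ->
  q`_(size B).-1 = \sum_(t <- B) q.[t] / \prod_(b <- B | b != t) (t - b).
Proof.
move=> uB le_qB.
pose L := \sum_(t <- B) (q.[t] / \prod_(b <- B | b != t) (t - b)) *:
            \prod_(b <- B | b != t) ('X - b%:P).
have pE t : \prod_(b <- B | b != t) ('X - b%:P) =
    \prod_(b <- [seq b <- B | b != t]) ('X - b%:P) by rewrite big_filter.
have sz t : t \in B -> size [seq b <- B | b != t] = (size B).-1.
  move=> tB; rewrite size_filter -(count_predC (pred1 t) B) count_uniq_mem //.
  by rewrite tB.
have qL : q = L.
  apply/eqP; rewrite -subr_eq0; apply/eqP.
  apply: (@roots_geq_poly_eq0 _ _ B) => //; last first.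
    rewrite (leq_trans (size_polyD _ _)) // size_polyN geq_max le_qB.
    rewrite (leq_trans (size_sum _ _ _)) //; apply/bigmax_leqP_seq => t tB _.
    rewrite (leq_trans (size_scale_leq _ _)) // pE size_prod_XsubC sz //.
    by case: (B) tB.
  apply/allP => t tB; rewrite /root hornerD hornerN horner_sum subr_eq0.
  rewrite (bigD1_seq t) //= hornerZ horner_prod.
  under [X in _ * X]eq_bigr do rewrite hornerXsubC.
  rewrite mulfVK; last by apply: prod_neq0_seq.
  rewrite big_seq_cond big1 ?addr0 // => s /andP[sB st].
  rewrite hornerZ pE horner_prod [X in _ * X](big_rem t) /=; last first.
    by rewrite mem_filter eq_sym st.
  by rewrite hornerXsubC subrr mul0r mulr0.
rewrite [in LHS]qL coef_sum; apply: eq_big_seq => t tB.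
rewrite coefZ pE; have /monicP := monic_prod_XsubC [seq b <- B | b != t] predT id.
by rewrite lead_coefE size_prod_XsubC sz //= => ->; rewrite mulr1.
Qed.

(** The sum of the residues of prod_A (u - a) / prod_B (u - b). Subtracting prod_B (u - b) from the
    numerator changes no value on [B] and lowers the degree, so [lagrange_coef] applies; its top
    coefficient is the difference of the sums. *)
Lemma partial_fractions A B : uniq B -> size A = size B ->
  \sum_(t <- B) (\prod_(a <- A) (t - a)) / \prod_(b <- B | b != t) (t - b)
    = \sum_(b <- B) b - \sum_(a <- A) a.
Proof.
case: B => [|b0 B0]; first by case: A => // _ _; rewrite !big_nil subrr.
set B := b0 :: B0 => uB sAB.
pose P C : {poly F} := \prod_(c <- C) ('X - c%:P).
have szP C : size (P C) = (size C).+1 by rewrite size_prod_XsubC.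
have cP C : (0 < size C)%N -> (P C)`_(size C).-1 = - \sum_(c <- C) c.
  by rewrite lt0n; exact: coefPn_prod_XsubC.
have lP C : (P C)`_(size C) = 1.
  by have /monicP := monic_prod_XsubC C predT id; rewrite lead_coefE szP.
have szq : (size (P A - P B)%R <= size B)%N.
  apply/leq_sizeP => j; rewrite leq_eqVlt => /predU1P[<-|ltj].
    by rewrite coefB lP -sAB lP subrr.
  by rewrite coefB !nth_default ?subrr // szP // sAB.
have := lagrange_coef uB szq; rewrite coefB cP // -sAB cP ?sAB // opprK addrC => ->.
apply: eq_big_seq => t tB; congr (_ / _).
have eP C : (P C).[t] = \prod_(c <- C) (t - c).
  by rewrite horner_prod; apply: eq_bigr => a _; rewrite hornerXsubC.
rewrite hornerD hornerN !eP [X in _ - X](big_rem t) //=.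
by rewrite subrr mul0r subr0.
Qed.

End PartialFractions.

Section TruncatedResidues.
Variable F : fieldType.
Variables X Y Z : seq F.

Definition doubles : seq F := [seq t <- X | t + 1 \in X].

(** The zeros of prod_X (u - x)(u + 1 - x), each listed once: a double pole becomes simple after one
    cancellation against the numerator. *)
Definition merged_poles : seq F :=
  X ++ [seq t <- [seq x - 1 | x <- X] | t \notin X].

(* The residue at t of prod_Y (u - y) prod_Z (u + 1 - z) over                  *)
(* prod_X (u - x)(u + 1 - x), once the double poles, which lie in [doubles],   *)
(* are cancelled against the factors u - y with y in [doubles].                *)
Definition reduced_residue (t : F) : F :=
  (\prod_(y <- Y | y \notin doubles) (t - y) * \prod_(z <- Z) (t + 1 - z))
  / \prod_(b <- merged_poles | b != t) (t - b).

Hypotheses (uX : uniq X) (uY : uniq Y) (sDY : {subset doubles <= Y}).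
Hypotheses (szY : size Y = (size X).+1) (szZ : (size Z).+1 = size X).

Let D := doubles.
Let X' := [seq t <- [seq x - 1 | x <- X] | t \notin X].

Lemma mem_doubles t : (t \in D) = (t \in X) && (t + 1 \in X).
Proof. by rewrite mem_filter andbC. Qed.

Lemma uniq_doubles : uniq D. Proof. exact: filter_uniq. Qed.

Lemma mem_pred_seq t : (t \in [seq x - 1 | x <- X]) = (t + 1 \in X).
Proof. by rewrite -{1}(addrK 1 t) (mem_map (addIr (-1))). Qed.

Lemma uniq_pred_seq : uniq [seq x - 1 | x <- X].
Proof. by rewrite (map_inj_uniq (addIr (-1))). Qed.

Lemma perm_pred_seq : perm_eq [seq x - 1 | x <- X] (D ++ X').
Proof.
apply: uniq_perm => [||t]; first exact: uniq_pred_seq.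
  rewrite cat_uniq uniq_doubles filter_uniq ?uniq_pred_seq // andbT.
  by apply/hasPn => t; rewrite mem_filter mem_doubles => /andP[/negbTE->].
rewrite mem_cat mem_doubles mem_filter mem_pred_seq.
by case: (t \in X); rewrite ?orbF.
Qed.

Lemma uniq_merged_poles : uniq merged_poles.
Proof.
rewrite cat_uniq uX filter_uniq ?uniq_pred_seq // andbT.
by apply/hasPn => t; rewrite mem_filter => /andP[].
Qed.

Lemma perm_common_doubles : perm_eq [seq y <- Y | y \in D] D.
Proof.
apply: uniq_perm => [||t]; rewrite ?filter_uniq ?uniq_doubles //.
by rewrite mem_filter; case: (boolP (t \in D)) => // /sDY->.
Qed.

Lemma prod_split_doubles t :
  \prod_(y <- Y) (t - y) =
  \prod_(y <- Y | y \notin D) (t - y) * \prod_(d <- D) (t - d).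
Proof.
rewrite (bigID (mem D)) /= mulrC; congr (_ * _).
by rewrite -big_filter (perm_big _ perm_common_doubles).
Qed.

Lemma prod_succ_split (P : pred F) t :
  \prod_(r <- X | P (r - 1)) (t + 1 - r) =
  \prod_(d <- D | P d) (t - d) * \prod_(b <- X' | P b) (t - b).
Proof.
rewrite -big_cat -(perm_big _ perm_pred_seq) /= big_map.
by apply: eq_bigr => r _; rewrite opprB addrA.
Qed.

(** With X, Y, Z the rows k, k+1, k-1, this is the coefficient of the closed path that raises x and
    lowers it back; [lower_raise_term] belongs to the opposite order. *)
Definition raise_lower_term (x : F) : F :=
  (\prod_(y <- Y) (x - y) / \prod_(r <- X | r != x) (x - r)) *
  (\prod_(z <- Z) (x + 1 - z) / \prod_(r <- X | r != x) (x + 1 - r)).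

Definition lower_raise_term (x : F) : F :=
  (\prod_(z <- Z) (x - z) / \prod_(r <- X | r != x) (x - r)) *
  (\prod_(y <- Y) (x - 1 - y) / \prod_(r <- X | r != x) (x - 1 - r)).

Lemma prod_at_mem (C : seq F) t : t \in C -> \prod_(c <- C) (t - c) = 0.
Proof. by move=> tC; rewrite (big_rem t) //= subrr mul0r. Qed.

Lemma raise_lower_term_double t : t \in D -> raise_lower_term t = 0.
Proof. by move=> /sDY/prod_at_mem; rewrite /raise_lower_term => ->; rewrite !mul0r. Qed.

Lemma lower_raise_term_double x : x - 1 \in D -> lower_raise_term x = 0.
Proof.
by move=> /sDY/prod_at_mem; rewrite /lower_raise_term => ->; rewrite !(mul0r, mulr0).
Qed.

(** At u = x the factor u + 1 - x of the denominator equals 1, so leaving it out does no harm; the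
    factors u - d with d double cancel. *)
Lemma raise_lower_term_simple x : x \in X -> x \notin D ->
  raise_lower_term x = reduced_residue x.
Proof.
move=> xX xD; rewrite /raise_lower_term /reduced_residue prod_split_doubles.
have D0 : \prod_(d <- D) (x - d) != 0.
  by apply: prod_neq0_seq => d dD _; apply: contraNneq xD => <-.
have -> : \prod_(r <- X | r != x) (x + 1 - r) =
    \prod_(d <- D) (x - d) * \prod_(b <- X') (x - b).
  rewrite -prod_succ_split [RHS](bigD1_seq x) //=.
  by rewrite addrAC subrr add0r mul1r.
rewrite big_cat /= -/X'.
have -> : \prod_(b <- X' | b != x) (x - b) = \prod_(b <- X') (x - b).
  rewrite big_seq_cond [RHS]big_seq; apply: eq_bigl => b.
  case: (boolP (b \in X')) => //=; rewrite mem_filter => /andP[bX _].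
  by apply: contraNneq bX => ->.
rewrite mulf_div; move: D0.
set d := \prod_(d <- D) _; set p := \prod_(y <- Y | _) _.
set q1 := \prod_(r <- X | _) _; set q2 := \prod_(b <- X') _ => D0.
set pz := \prod_(z <- Z) _.
have -> : p * d * pz = d * (p * pz) by ring.
have -> : q1 * (d * q2) = d * (q1 * q2) by ring.
by rewrite -mulf_div divff // mul1r.
Qed.

(** As for raising, but at u = x - 1, where the factor u - x equals -1; hence the sign. *)
Lemma lower_raise_term_simple x : x \in X -> x - 1 \notin X ->
  lower_raise_term x = - reduced_residue (x - 1).
Proof.
move=> xX xX'; rewrite /lower_raise_term /reduced_residue prod_split_doubles.
have D0 : \prod_(d <- D) (x - 1 - d) != 0.
  by apply: prod_neq0_seq => d; rewrite mem_doubles => /andP[dX _] _;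
     apply: contraNneq xX' => <-.
rewrite !subrK big_cat /= -/X'.
have -> : \prod_(b <- X | b != x - 1) (x - 1 - b) =
    - \prod_(b <- X | b != x) (x - 1 - b).
  transitivity (\prod_(b <- X) (x - 1 - b)).
    rewrite big_seq_cond [RHS]big_seq; apply: eq_bigl => b.
    by case: (boolP (b \in X)) => //= bX; apply: contraNneq xX' => <-.
  rewrite (bigD1_seq x) //=.
  by rewrite addrAC subrr add0r mulN1r.
have -> : \prod_(r <- X | r != x) (x - r) =
    \prod_(d <- D) (x - 1 - d) * \prod_(b <- X' | b != x - 1) (x - 1 - b).
  have := prod_succ_split (fun b => b != x - 1) (x - 1).
  rewrite subrK.
  under eq_bigl do rewrite (inj_eq (addIr (-1))).
  move=> ->; congr (_ * _); rewrite big_seq_cond [RHS]big_seq.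
  apply: eq_bigl => b; case: (boolP (b \in D)) => //=.
  by rewrite mem_doubles => /andP[bX _]; apply: contraNneq xX' => <-.
rewrite mulf_div; move: D0.
set d := \prod_(d <- D) _; set p := \prod_(y <- Y | _) _.
set q1 := \prod_(r <- X | _) _; set q2 := \prod_(b <- X' | _) _ => D0.
set pz := \prod_(z <- Z) _.
have -> : pz * (p * d) = d * (p * pz) by ring.
have -> : d * q2 * q1 = d * (q1 * q2) by ring.
by rewrite -mulf_div divff // mul1r mulNr invrN mulrN opprK.
Qed.

(** All residues together are given by [partial_fractions]. The raising terms supply those at the
    simple poles in X, the lowering terms those at the poles in X - 1 outside X, and the double
    poles are left over. *)
Lemma sum_terms_reduced_residue :
  \sum_(x <- X) raise_lower_term x - \sum_(x <- X) lower_raise_term x =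
  2 * \sum_(x <- X) x - \sum_(y <- Y) y - \sum_(z <- Z) z - 1
  - \sum_(t <- doubles) reduced_residue t.
Proof.
(* The zeros of the reduced numerator, the factor u + 1 - z vanishing at z - 1. The count |Y| - |D|
   + |Z| = 2|X| - |D| is the number of merged poles. *)
pose A := [seq y <- Y | y \notin D] ++ [seq z - 1 | z <- Z].
have sumpred (C : seq F) : \sum_(c <- [seq c - 1 | c <- C]) c =
    \sum_(c <- C) c - (size C)%:R.
  rewrite big_map big_split /= sumrN; congr (_ - _).
  by rewrite big_const_seq count_predT -Monoid.iteropE.
have szX' : (size D + size X')%N = size X.
  by rewrite -size_cat -(perm_size perm_pred_seq) size_map.
have szA : size A = size merged_poles.
  rewrite !size_cat size_map -/X'.
  have := count_predC (mem D) Y.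
  rewrite -!size_filter (perm_size perm_common_doubles).
  rewrite (eq_filter (a2 := fun y => y \notin D)) // szY; move: szX' szZ.
  move: (size X') (size X) (size D) (size Z) (size _) => *; lia.
have perm_X : perm_eq [seq x <- X | x \in D] D.
  apply: uniq_perm => [||t]; rewrite ?filter_uniq ?uniq_doubles //.
  by rewrite mem_filter mem_doubles; case: (t \in X); rewrite ?andbT.
have sumX : \sum_(x <- X) raise_lower_term x =
    \sum_(x <- X) reduced_residue x - \sum_(t <- D) reduced_residue t.
  rewrite (bigID (mem D)) /= [X in _ = X - _](bigID (mem D)) /=.
  rewrite big1 ?add0r => [|x]; last exact: raise_lower_term_double.
  rewrite -[\sum_(x <- X | x \in D) _]big_filter (perm_big _ perm_X) /=.
  rewrite addrAC subrr add0r big_seq_cond [RHS]big_seq_cond.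
  by apply: eq_bigr => x /andP[xX xD]; exact: raise_lower_term_simple.
have sumX' : \sum_(x <- X) lower_raise_term x =
    - \sum_(x <- X') reduced_residue x.
  rewrite (bigID (fun x => x - 1 \in X)) /= big_seq_cond.
  rewrite big1 ?add0r => [|x /andP[xX xX']]; last first.
    by apply: lower_raise_term_double; rewrite mem_doubles xX' subrK.
  rewrite big_filter big_map -sumrN big_seq_cond [RHS]big_seq_cond.
  by apply: eq_bigr => x /andP[xX xX']; exact: lower_raise_term_simple.
have := partial_fractions uniq_merged_poles szA.
have -> : \sum_(t <- merged_poles)
      (\prod_(a <- A) (t - a)) / \prod_(b <- merged_poles | b != t) (t - b)
    = \sum_(t <- merged_poles) reduced_residue t.
  apply: eq_bigr => t _; rewrite /reduced_residue big_cat big_filter big_map /=.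
  by congr (_ * _ / _); apply: eq_bigr => z _; rewrite opprB addrA.
rewrite !big_cat /= -/X' sumX sumX' sumpred big_filter.
have := perm_big _ perm_pred_seq (op := +%R) (x := 0) (P := predT) (F := id).
rewrite /= sumpred big_cat /= -szZ -natr1.
have -> : \sum_(y <- Y) y =
    \sum_(d <- D) d + \sum_(y <- Y | y \notin D) y.
  rewrite (bigID (mem D)) /=; congr (_ + _).
  by rewrite -big_filter (perm_big _ perm_common_doubles).
set sX := \sum_(x <- X) x; set sD := \sum_(d <- D) d => e1 e2.
have e1' : \sum_(i <- X') i = sX - ((size Z)%:R + 1) - sD.
  by rewrite e1 addrAC subrr add0r.
transitivity (\sum_(i <- X) reduced_residue i
    + \sum_(i <- X') reduced_residue i - \sum_(t <- D) reduced_residue t).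
  by ring.
by rewrite e2 e1' /D; ring.
Qed.

End TruncatedResidues.

(** * Interlacing patterns *)

Section Entries.
Variable n : nat.
Implicit Type L : tableau n.

Definition position (a b : nat) : bool := (1 <= b <= a)%N && (a <= n)%N.

Lemma at_posE a b p : at_pos a b p ->
  forall a' b', at_pos (n := n) a' b' p = (a == a') && (b == b').
Proof. by case/andP=> /eqP<- /eqP<-. Qed.

Lemma at_pos_exists a b : position a b -> exists p, at_pos (n := n) a b p.
Proof.
case/andP=> /andP[b0 leba] lean.
have lta : (a.-1 < n)%N by lia.
have ltb : (b.-1 < (Ordinal lta).+1)%N by rewrite /=; lia.
exists (Tagged (fun a : 'I_n => 'I_a.+1) (Ordinal ltb)).
by rewrite /at_pos /=; lia.
Qed.

Lemma entry_at L a b p : at_pos a b p -> entry L a b = L p.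
Proof.
move=> abp; rewrite /entry; case: pickP => [q abq|/(_ p)]; last by rewrite abp.
congr (L _); case: p q abp abq => [u v] [u' v'] /andP[/= e1 e2] /andP[/= e3 e4].
have uu : u = u' by apply: val_inj => /=; move: e1 e3; lia.
case: u' / uu v' e3 e4 => v' _ e4; congr existT.
by apply: val_inj => /=; move: e2 e4; lia.
Qed.

Lemma entry_shift L k m c a b : position k m ->
  entry (shift L k m c) a b =
  entry L a b + (if (a == k) && (b == m) then c else 0).
Proof.
move=> /at_pos_exists[p0 p0P]; rewrite /entry; case: pickP => [p pP|noP].
  by rewrite ffunE (at_posE pP).
case: ifP => [/andP[/eqP ea /eqP eb]|]; last by rewrite addr0.
by move: (noP p0); rewrite ea eb p0P.
Qed.

End Entries.

Section Interlacing.
Variables (n : nat) (i i' : nat -> nat) (top : nat -> int).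
Hypothesis i_range : forall k : nat, (1 <= k < n)%N ->
  [/\ (i k <= k)%N, (1 <= i' k <= k.+1)%N & (i k < i' k)%N].
Hypothesis top_decr : forall j : nat, (1 <= j < n)%N -> top j.+1 < top j.

(* l_kj lies in the interval number [slot k j] cut out by row k+1, interval s  *)
(* being l_{k+1,s} >= x > l_{k+1,s+1}; intervals i_k and i'_k stay empty.      *)
Definition slot (k j : nat) : nat :=
  if (j <= i k)%N then j.-1 else if (j < i' k)%N then j else j.+1.

Lemma slot_bound k j : (1 <= k < n)%N -> (1 <= j <= k)%N -> (slot k j <= k.+1)%N.
Proof. by move=> /i_range[? ? ?] ?; rewrite /slot; do ?case: ifP; lia. Qed.

Lemma slot_lt k j j' : (1 <= k < n)%N -> (1 <= j)%N -> (j < j')%N -> (j' <= k)%N ->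
  (slot k j < slot k j')%N.
Proof. by move=> /i_range[? ? ?] *; rewrite /slot; do ?case: ifP; lia. Qed.

Lemma slot_neq_gap k j : (1 <= k < n)%N -> (1 <= j <= k)%N ->
  slot k j != i k /\ slot k j != i' k.
Proof. by move=> /i_range[? ? ?] *; rewrite /slot; do ?case: ifP; lia. Qed.

Lemma slot_surj k g : (1 <= k < n)%N -> (g <= k.+1)%N -> g != i k -> g != i' k ->
  exists2 j, (1 <= j <= k)%N & slot k j = g.
Proof.
move=> /i_range[? ? ?] *.
by exists (if (g < i k)%N then g.+1 else if (g < i' k)%N then g else g.-1);
  rewrite /slot; do ?case: ifP; lia.
Qed.

(** [slot k] skips the empty intervals i_k and i'_k just after j = i_k and j = i'_k - 1; this is the
    origin of these two numbers in the LP-condition. *)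
Lemma slot_succ k j j' : (1 <= k < n)%N -> (1 <= j)%N -> (j < j')%N -> (j' <= k)%N ->
  (slot k j' <= (slot k j).+1)%N ->
  [/\ j' = j.+1, j != i k & j != (i' k).-1].
Proof.
by move=> /i_range[? ? ?] ? ? ?; rewrite /slot; do ?case: ifP => ?; split; lia.
Qed.

Lemma slotS k j : (1 <= k < n)%N -> (1 <= j < k)%N -> j != i k ->
  j != (i' k).-1 -> slot k j.+1 = (slot k j).+1.
Proof. by move=> /i_range[? ? ?] ? ? ?; rewrite /slot; do ?case: ifP => ?; lia. Qed.

(** One equality of booleans for every s encodes both bounds on l_kj; in the outermost intervals 0
    and k + 1 the missing bound disappears by itself. *)
Definition interlacing (l : nat -> nat -> int) : Prop :=
  forall k j s, (1 <= k < n)%N -> (1 <= j <= k)%N -> (1 <= s <= k.+1)%N ->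
    (l k j <= l k.+1 s) = (s <= slot k j)%N.

Definition row_decr (y : nat -> int) (m : nat) : Prop :=
  forall j, (1 <= j < m)%N -> y j.+1 < y j.

Lemma row_decr_lt y m a b : row_decr y m ->
  (1 <= a)%N -> (a < b)%N -> (b <= m)%N -> y b < y a.
Proof.
move=> dy a1; elim: b => // b IH; rewrite ltnS leq_eqVlt => /predU1P[<-|ltab] lebm.
  by apply: dy; lia.
by apply: lt_trans (dy _ _) (IH ltab _); lia.
Qed.

Lemma row_decr_le y m a b : row_decr y m ->
  (1 <= a)%N -> (a <= b)%N -> (b <= m)%N -> y b <= y a.
Proof.
move=> dy a1; rewrite leq_eqVlt => /predU1P[->|ltab] lebm //.
exact/ltW/(row_decr_lt dy).
Qed.

Lemma GG_betweenP (L : tableau n) k j : (1 <= k < n)%N -> (1 <= j <= k)%N ->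
  GG_between i i' L k j <->
  ((1 <= slot k j)%N -> entry L k j <= entry L k.+1 (slot k j)) /\
  ((slot k j < k.+1)%N -> entry L k.+1 (slot k j).+1 < entry L k j).
Proof.
move=> /i_range[ik i'k ii'] /andP[j1 jk]; rewrite /GG_between /slot.
have [le_ji|lt_ij] := leqP j (i k).
  rewrite (_ : (i' k <= j)%N = false) /=; last by lia.
  rewrite andbT (prednK j1); split.
    by case/andP=> A B; split=> // j2; apply: (implyP A); lia.
  case=> A B; rewrite B ?andbT; last lia.
  by apply/implyP => ?; apply: A; lia.
have [lt_ji'|le_i'j] := ltnP j (i' k); rewrite /=.
  rewrite andbT; split; first by case/andP.
  by case=> A B; rewrite A ?B //; lia.
split=> [/andP[A /implyP B]|[A B]]; first by split=> // ?; apply: B; lia.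
by rewrite A //=; apply/implyP => ?; apply: B; lia.
Qed.

(** Consecutive entries lie in different intervals of row k+1, so some entry of row k+1 separates
    them. *)
Lemma interlacing_row_decr (L : tableau n) k : interlacing (entry L) ->
  (1 <= k < n)%N -> row_decr (entry L k.+1) k.+1 -> row_decr (entry L k) k.
Proof.
move=> int_L kn dy j jk.
have sj : (slot k j < slot k j.+1)%N by apply: slot_lt; lia.
have sb : (slot k j.+1 <= k.+1)%N by apply: slot_bound; lia.
have up : entry L k j.+1 <= entry L k.+1 (slot k j.+1).
  by rewrite int_L //; lia.
apply: le_lt_trans up _; rewrite ltNge int_L //; lia.
Qed.

Lemma interlacing_rows_decr (L : tableau n) :
  (forall j, (1 <= j <= n)%N -> entry L n j = top j) -> interlacing (entry L) ->
  forall k, (1 <= k <= n)%N -> row_decr (entry L k) k.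
Proof.
move=> tL int_L k kn; rewrite -(subKn (_ : k <= n)%N); last by case/andP: kn.
have : (n - k < n)%N by lia.
elim: (n - k)%N => [_|d IH ltd].
  by rewrite subn0 => j jn; rewrite !tL ?top_decr //; lia.
apply: interlacing_row_decr => //; first lia.
by rewrite (_ : (n - d.+1).+1 = (n - d)%N); [apply: IH|]; lia.
Qed.

(** The inequalities say that [slot] locates every entry, and strict decrease propagates downwards
    from the top row. *)
Lemma GG_basisP (L : tableau n) :
  has_top_row top L && GG_condition i i' L <->
  (forall j, (1 <= j <= n)%N -> entry L n j = top j) /\ interlacing (entry L).
Proof.
split=> [/andP[/forallP tL /andP[/forallP dL /forallP bL]]|[tL int_L]].
  split=> [[//|j] /andP[_ ltj]|k j s kn jk sk].
    exact/eqP/(tL (Ordinal ltj)).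
  have ltk : (k < n)%N by lia.
  have ltk1 : (k.+1 < n.+1)%N by lia.
  have dy : row_decr (entry L k.+1) k.+1.
    move=> t tk; have ltt : (t < n.+1)%N by lia.
    move/forallP/(_ (Ordinal ltt)): (dL (Ordinal ltk1)) => /=.
    by rewrite tk.
  have ltj : (j < n)%N by lia.
  have := forallP (bL (Ordinal ltk)) (Ordinal ltj); rewrite /= jk /=.
  case/(GG_betweenP _ kn jk) => up lo.
  have sb := slot_bound kn jk.
  have [le_s|lt_s] := leqP s (slot k j).
    apply: le_trans (up _) (row_decr_le dy _ le_s _); lia.
  apply/negbTE; rewrite -ltNge; apply: le_lt_trans (lo _); last lia.
  by apply: (row_decr_le dy); lia.
have dL := interlacing_rows_decr tL int_L.
apply/andP; split.
  by apply/forallP => j; rewrite tL //=; exact: ltn_ord.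
apply/andP; split; apply/forallP => k; apply/forallP => j; apply/implyP => jk.
  by apply: dL => //; have := ltn_ord k; lia.
have kn : (1 <= k < n)%N by have := ltn_ord k; lia.
have sb := slot_bound kn jk.
apply/(GG_betweenP _ kn jk); split=> ?; first by rewrite int_L ?leqnn //; lia.
by rewrite ltNge int_L ?ltnn //; lia.
Qed.

End Interlacing.

(** * Operators on a free module *)

(* The endomorphisms of a free module, encoded by the images of the basis.    *)
Section FreeModuleOperators.
Variables (F : fieldType) (K : choiceType).
Local Notation V := {malg F[K]}.
Local Notation A := (K -> V).
Implicit Types (f g : A) (v w : V).

Definition lin_ext f v : V := \sum_(b <- msupp v) v@_b *: f b.

Lemma lin_ext_supp f v (d : {fset K}) : {subset msupp v <= d} ->
  lin_ext f v = \sum_(b <- d) v@_b *: f b.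
Proof.
move=> /fsubsetP le_vd; rewrite /lin_ext (big_fset_incl _ le_vd) // => b _.
by rewrite -mcoeff_eq0 => /eqP->; rewrite scale0r.
Qed.

Lemma lin_extP a f v w : lin_ext f (a *: v + w) = a *: lin_ext f v + lin_ext f w.
Proof.
pose d := (msupp v `|` msupp w)%fset.
have le_d : {subset msupp (a *: v + w) <= d}.
  apply/fsubsetP/(fsubset_trans (msuppD_le _ _)).
  exact/fsetSU/msuppZ_le.
rewrite (lin_ext_supp _ le_d) (@lin_ext_supp f v d); last first.
  by apply/fsubsetP/fsubsetUl.
rewrite (@lin_ext_supp f w d); last by apply/fsubsetP/fsubsetUr.
rewrite scaler_sumr -big_split; apply: eq_bigr => b _ /=.
by rewrite mcoeffD mcoeffZ scalerDl scalerA.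
Qed.

Lemma lin_ext0 f : lin_ext f 0 = 0.
Proof. by rewrite /lin_ext msupp0 big_seq_fset0. Qed.

Lemma lin_extZ a f v : lin_ext f (a *: v) = a *: lin_ext f v.
Proof. by rewrite -[a *: v]addr0 lin_extP lin_ext0 addr0. Qed.

Lemma lin_ext_basis f b : lin_ext f << b >> = f b.
Proof.
rewrite (@lin_ext_supp f _ [fset b]%fset); last by apply/fsubsetP/msuppU_le.
by rewrite big_seq_fset1 mcoeffUU scale1r.
Qed.

Lemma lin_ext_linl a f g v :
  lin_ext (a *: f + g) v = a *: lin_ext f v + lin_ext g v.
Proof.
rewrite /lin_ext scaler_sumr -big_split; apply: eq_bigr => b _ /=.
by rewrite scalerDr !scalerA mulrC.
Qed.

Lemma lin_ext_subl f g v : lin_ext (f - g) v = lin_ext f v - lin_ext g v.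
Proof. by rewrite [f - g]addrC -scaleN1r lin_ext_linl scaleN1r addrC. Qed.

Definition op_mul f g : A := fun b => lin_ext f (g b).

Lemma lin_ext_mul f g v : lin_ext (op_mul f g) v = lin_ext f (lin_ext g v).
Proof.
rewrite {1 3}/lin_ext; elim/big_rec2: _ => [|b y1 y2 _ IH]; first by rewrite lin_ext0.
by rewrite lin_extP -IH.
Qed.

Lemma op_mulA : associative op_mul.
Proof. by move=> f g k; apply: funext => b; rewrite /op_mul lin_ext_mul. Qed.

Definition op_one : A := fun b => << b >>.

Lemma op_mul1l f : op_mul op_one f = f.
Proof.
apply: funext => b; rewrite /op_mul /lin_ext [RHS]monalgE.
apply: eq_bigr => c _; apply/malgP => c'.
by rewrite mcoeffZ !mcoeffU mulr_natr.
Qed.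

Lemma op_mul_linl a f g k : op_mul (a *: f + g) k = a *: op_mul f k + op_mul g k.
Proof. by apply: funext => b; rewrite /op_mul lin_ext_linl. Qed.

Lemma op_mul_linr a f g k : op_mul k (a *: f + g) = a *: op_mul k f + op_mul k g.
Proof. by apply: funext => b; rewrite /op_mul lin_extP. Qed.

Definition op_br f g : A := op_mul f g - op_mul g f.

Lemma op_mulDl f g k : op_mul (f + g) k = op_mul f k + op_mul g k.
Proof. by rewrite -[f]scale1r op_mul_linl !scale1r. Qed.

Lemma op_mulDr f g k : op_mul k (f + g) = op_mul k f + op_mul k g.
Proof. by rewrite -[f]scale1r op_mul_linr !scale1r. Qed.

Lemma op_mul0l f : op_mul 0 f = 0.
Proof. by apply: (addrI (op_mul 0 f)); rewrite -op_mulDl !addr0. Qed.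

Lemma op_mul0r f : op_mul f 0 = 0.
Proof. by apply: (addrI (op_mul f 0)); rewrite -op_mulDr !addr0. Qed.

Lemma op_mulNl f g : op_mul (- f) g = - op_mul f g.
Proof. by apply/eqP; rewrite -addr_eq0 -op_mulDl addNr op_mul0l. Qed.

Lemma op_mulNr f g : op_mul f (- g) = - op_mul f g.
Proof. by apply/eqP; rewrite -addr_eq0 -op_mulDr addNr op_mul0r. Qed.

Lemma op_mulBl f g k : op_mul (f - g) k = op_mul f k - op_mul g k.
Proof. by rewrite op_mulDl op_mulNl. Qed.

Lemma op_mulBr f g k : op_mul k (f - g) = op_mul k f - op_mul k g.
Proof. by rewrite op_mulDr op_mulNr. Qed.

Lemma op_mul_suml (I : Type) (r : seq I) (P : pred I) (E : I -> A) g :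
  op_mul (\sum_(i <- r | P i) E i) g = \sum_(i <- r | P i) op_mul (E i) g.
Proof. by apply: (big_morph (op_mul^~ g)) => [f k|]; rewrite ?op_mulDl ?op_mul0l. Qed.

Lemma op_mul_sumr (I : Type) (r : seq I) (P : pred I) (E : I -> A) g :
  op_mul g (\sum_(i <- r | P i) E i) = \sum_(i <- r | P i) op_mul g (E i).
Proof. by apply: (big_morph (op_mul g)) => [f k|]; rewrite ?op_mulDr ?op_mul0r. Qed.

Lemma op_lie_bracket : lie_bracket op_br.
Proof.
split=> [f g k|f g|f g k]; rewrite /op_br.
- by rewrite op_mulDl op_mulDr opprD addrACA.
- by rewrite opprB.
rewrite !op_mulBl !op_mulBr !op_mulA.
have zE (W : zmodType) (a b c d p q : W) :
    a - b - (c - d) = a - p - (q - d) + (p - c - (b - q)).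
  rewrite !opprB !addrA [RHS](ACl (1*8*3*6*2*5*4*7))%AC /=.
  by rewrite !subrK.
exact: zE.
Qed.

Lemma op_mulZl a f g : op_mul (a *: f) g = a *: op_mul f g.
Proof. by rewrite -[a *: f]addr0 op_mul_linl op_mul0l addr0. Qed.

Lemma op_mulZr a f g : op_mul f (a *: g) = a *: op_mul f g.
Proof. by rewrite -[a *: g]addr0 op_mul_linr op_mul0r addr0. Qed.

Lemma op_br_suml (I : Type) (r : seq I) (c : I -> F) (E : I -> A) g :
  op_br (\sum_(i <- r) c i *: E i) g = \sum_(i <- r) c i *: op_br (E i) g.
Proof.
rewrite /op_br op_mul_suml op_mul_sumr -sumrB; apply: eq_bigr => i _.
by rewrite op_mulZl op_mulZr scalerBr.
Qed.

Lemma op_br_sumr (I : Type) (r : seq I) (c : I -> F) (E : I -> A) g :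
  op_br g (\sum_(i <- r) c i *: E i) = \sum_(i <- r) c i *: op_br g (E i).
Proof.
rewrite (brC op_lie_bracket) op_br_suml -sumrN; apply: eq_bigr => i _.
by rewrite -scalerN -(brC op_lie_bracket).
Qed.

Section GlRep.
Variables (n : nat) (E : nat -> nat -> A).
Hypothesis relE : gl_relations op_br E n.

Definition mx_op (X : 'M[F]_n) : A :=
  \sum_(p : 'I_n * 'I_n) X p.1 p.2 *: E p.1 p.2.

Lemma mx_op_delta a b : mx_op (delta_mx a b) = E a b.
Proof.
rewrite /mx_op (bigD1 (a, b)) //= mxE !eqxx scale1r big1 ?addr0 // => -[c d] /=.
by rewrite xpair_eqE mxE => /negbTE->; rewrite scale0r.
Qed.

Lemma mx_opP a X Y : mx_op (a *: X + Y) = a *: mx_op X + mx_op Y.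
Proof.
rewrite /mx_op scaler_sumr -big_split; apply: eq_bigr => p _ /=.
by rewrite !mxE scalerDl scalerA.
Qed.

Lemma mx_op_br X Y : op_br (mx_op X) (mx_op Y) = mx_op (X *m Y - Y *m X).
Proof.
(* The product is written as a double sum over positions with a Kronecker delta, the shape that
   [relE] gives to the bracket. *)
have mxM (X1 X2 : 'M[F]_n) : mx_op (X1 *m X2) =
    \sum_(p : 'I_n * 'I_n) \sum_(q : 'I_n * 'I_n)
       X1 p.1 p.2 *: (X2 q.1 q.2 *: (E p.1 q.2 *+ (p.2 == q.1))).
  rewrite -(pair_bigA _ (fun i j =>
    \sum_q X1 i j *: (X2 q.1 q.2 *: (E i q.2 *+ (j == q.1))))) /=.
  rewrite /mx_op -(pair_bigA _ (fun i l => (X1 *m X2) i l *: E i l)) /=.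
  apply: eq_bigr => i _.
  under [RHS]eq_bigr => j _.
    rewrite -(pair_bigA _ (fun k l => X1 i j *: (X2 k l *: (E i l *+ (j == k))))) /=.
    rewrite (bigD1 j) //= [X in _ + X]big1 ?addr0; last first.
      move=> k /negbTE jk; rewrite big1 // => l _.
      by rewrite eq_sym jk mulr0n !scaler0.
    over.
  rewrite exchange_big; apply: eq_bigr => l _ /=.
  rewrite mxE scaler_suml; apply: eq_bigr => j _.
  by rewrite eqxx mulr1n scalerA.
have -> : mx_op (X *m Y - Y *m X) = mx_op (X *m Y) - mx_op (Y *m X).
  by rewrite addrC -scaleN1r mx_opP scaleN1r addrC.
rewrite !mxM [X in _ - X]exchange_big -sumrB /= op_br_suml.
apply: eq_bigr => -[i j] _; rewrite op_br_sumr -sumrB scaler_sumr.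
apply: eq_bigr => -[k l] _ /=.
rewrite relE ?ltn_ord // !scalerBr; congr (_ - _).
by rewrite !scalerA mulrC (eq_sym l).
Qed.

Lemma gl_rep_mx_op : gl_rep (fun X v => lin_ext (mx_op X) v : V).
Proof.
split=> [X a u v|v a X Y|X Y v]; first exact: lin_extP.
  by rewrite mx_opP lin_ext_linl.
by rewrite -mx_op_br /op_br -!lin_ext_mul lin_ext_subl.
Qed.

End GlRep.

End FreeModuleOperators.

(** * Path coefficients *)

Section Paths.
Variables (F : numFieldType) (n : nat).
Implicit Types (L : tableau n).

Local Notation l L a b := ((entry L a b)%:~R : F).

Record step := Step { srow : nat; scol : nat; sup : bool }.
Implicit Types (s : step) (w : seq step).

Definition step_ok s : bool := (1 <= scol s <= srow s)%N && (srow s < n)%N.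
Definition sgn s : int := if sup s then 1 else -1.
Definition partner s : nat := if sup s then (srow s).+1 else (srow s).-1.
Definition move L s : tableau n := shift L (srow s) (scol s) (sgn s).

Definition row_prod L r (u : F) : F := \prod_(1 <= j < r.+1) (u - l L r j).
Definition row_prod_but L r m (u : F) : F :=
  \prod_(1 <= j < r.+1 | j != m) (u - l L r j).

(** The Gelfand-Tsetlin coefficient without the leading minus sign of the raising formula, which
    [raise_op] restores. *)
Definition coef L s : F :=
  row_prod L (partner s) (l L (srow s) (scol s))
  / row_prod_but L (srow s) (scol s) (l L (srow s) (scol s)).

Lemma step_ok_pos s : step_ok s -> position n (srow s) (scol s).
Proof. by rewrite /step_ok /position => /andP[-> /ltnW->]. Qed.

Lemma entry_move L s a b : step_ok s ->
  entry (move L s) a b =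
  entry L a b + (if (a == srow s) && (b == scol s) then sgn s else 0).
Proof. by move=> /step_ok_pos; exact: entry_shift. Qed.

Lemma row_prod_eq0 L r j u : (1 <= j <= r)%N -> u = l L r j -> row_prod L r u = 0.
Proof.
move=> jr ->; rewrite /row_prod (big_rem j) /= ?subrr ?mul0r //.
by rewrite mem_index_iota; lia.
Qed.

(* Junk coefficients (quotients by zero) past the first bad tableau of a path  *)
(* are harmless, since they are multiplied by the zero coefficient below.      *)
Fixpoint path_coef L w : F :=
  if w is s :: w' then coef L s * path_coef (move L s) w' else 1.

(* x moves from x = y to x = y + 1 with coefficient 0: a raise of x sees the   *)
(* row of y, and a lowering of y sees the row of x.                            *)
Lemma coef_cross L s k j t : step_ok s -> (1 <= j <= k)%N -> (1 <= t <= k.+1)%N ->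
  entry L k j <= entry L k.+1 t ->
  ~~ (entry (move L s) k j <= entry (move L s) k.+1 t) -> coef L s = 0.
Proof.
move=> s_ok jk tk; rewrite !entry_move //; move: s_ok.
rewrite /coef /partner /sgn /step_ok; case: s => a b [] /= s_ok; last first.
  case: ifP => [/andP[/eqP ka /eqP jb]|_].
    have -> /= : (k.+1 == a) = false by lia.
    by lia.
  case: ifP => [/andP[/eqP ka /eqP jb]|_]; last by lia.
  move=> le1 le2; rewrite (row_prod_eq0 (j := j)) ?mul0r //; first by lia.
  by rewrite -ka -jb /=; congr (_%:~R); lia.
case: ifP => [/andP[/eqP ka /eqP jb]|_]; last by case: ifP; lia.
have -> /= : (k.+1 == a) = false by lia.
move=> le1 le2; rewrite (row_prod_eq0 (j := t)) ?mul0r //; first by lia.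
by rewrite -ka -jb /=; congr (_%:~R); lia.
Qed.

(** Some step of the path is the one at which the comparison turns from true to false, and its
    coefficient is 0. *)
Lemma path_coef_cross L w k j t : all step_ok w -> (1 <= j <= k)%N ->
  (1 <= t <= k.+1)%N -> entry L k j <= entry L k.+1 t ->
  ~~ (entry (foldl move L w) k j <= entry (foldl move L w) k.+1 t) ->
  path_coef L w = 0.
Proof.
move=> + jk tk; elim: w L => [|s w IH] L /=; first by move=> _ ->.
case/andP=> s_ok w_ok le1 nle.
have [le2|nle2] := boolP (entry (move L s) k j <= entry (move L s) k.+1 t).
  by rewrite IH ?mulr0.
by rewrite (coef_cross s_ok jk tk le1 nle2) mul0r.
Qed.

(** The first step of the word acts first, so words list the factors of a product in reverse
    order. *)
Fixpoint op_word (K : choiceType) (op : step -> K -> {malg F[K]}) w :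
    K -> {malg F[K]} :=
  if w is s :: w' then op_mul (op_word op w') (op s) else @op_one F K.

Lemma op_word1 (K : choiceType) (op : step -> K -> {malg F[K]}) s :
  op s = op_word op [:: s].
Proof. by rewrite /= op_mul1l. Qed.

Lemma op_word2 (K : choiceType) (op : step -> K -> {malg F[K]}) s1 s2 :
  op_mul (op s1) (op s2) = op_word op [:: s2; s1].
Proof. by rewrite /= op_mul1l. Qed.

Lemma op_word3 (K : choiceType) (op : step -> K -> {malg F[K]}) s1 s2 s3 :
  op_mul (op s1) (op_mul (op s2) (op s3)) = op_word op [:: s3; s2; s1].
Proof. by rewrite /= op_mul1l op_mulA. Qed.

Section Module.
Variables (i i' : nat -> nat) (top : nat -> int).
Hypothesis i_range : forall k : nat, (1 <= k < n)%N ->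
  [/\ (i k <= k)%N, (1 <= i' k <= k.+1)%N & (i k < i' k)%N].
Hypothesis top_decr : forall j : nat, (1 <= j < n)%N -> top j.+1 < top j.

Local Notation B := (GG_basis n i i' top).
Local Notation A := (B -> {malg F[B]}).
Local Notation GG L := (has_top_row top L && GG_condition i i' L).
Local Notation T := (@T n i i' top F).

Definition step_op s : A := fun b => coef (val b) s *: T (move (val b) s).

Lemma T_val (b : B) : T (val b) = << b >>.
Proof. by rewrite /T valK. Qed.

Lemma T_out L : ~~ GG L -> T L = 0.
Proof. by move=> nL; rewrite /T insubN. Qed.

(** A step out of the basis changes some comparison between rows k and k+1. If the path ends in the
    basis, the comparison changes back later; one of the two changes goes from <= to > and
    contributes a factor 0. *)
Lemma op_word_step_op w (b : B) : all step_ok w ->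
  op_word step_op w b = path_coef (val b) w *: T (foldl move (val b) w).
Proof.
elim: w b => [|s w IH] b /=; first by rewrite /op_one scale1r T_val.
case/andP=> s_ok w_ok; rewrite /op_mul /step_op lin_extZ.
have [GGs|nGGs] := boolP (GG (move (val b) s)).
  pose b' : B := Sub (move (val b) s) GGs.
  have eb : move (val b) s = val b' by [].
  rewrite eb (T_val b') (lin_ext_basis _ b') (IH b' w_ok).
  exact: scalerA.
rewrite (T_out nGGs) lin_ext0 scaler0.
have [GGw|nGGw] := boolP (GG (foldl move (move (val b) s) w)); last first.
  by rewrite (T_out nGGw) scaler0.
suff -> : coef (val b) s * path_coef (move (val b) s) w = 0 by rewrite scale0r.
have [topb intb] := (GG_basisP i_range top_decr (val b)).1 (valP b).
have [_ intw] := (GG_basisP i_range top_decr _).1 GGw.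
apply/eqP; rewrite mulf_eq0; apply/contraNT: nGGs; rewrite negb_or => /andP[c0 p0].
apply/(GG_basisP i_range top_decr); split=> [j jn|k j t kn jk tk].
  rewrite entry_move // topb // (_ : (n == srow s) = false) ?addr0 //.
  by case/andP: s_ok; lia.
rewrite -intb //; apply/idP/idP => [le1|le1].
  apply: contraNT p0 => nle; apply/eqP.
  apply: (path_coef_cross w_ok jk tk le1).
  by rewrite intw // -(intb k j t).
by apply: contraNT c0 => nle; rewrite (coef_cross s_ok jk tk le1 nle).
Qed.

End Module.
End Paths.

(** * Adjacent entries of a row and the LP-condition *)

Section AdjacentEntries.
Variables (n : nat) (i i' : nat -> nat).
Hypothesis i_range : forall k : nat, (1 <= k < n)%N ->
  [/\ (i k <= k)%N, (1 <= i' k <= k.+1)%N & (i k < i' k)%N].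
Variable l : nat -> nat -> int.
Hypothesis l_int : interlacing n i i' l.
Hypothesis l_decr : forall k, (1 <= k <= n)%N -> row_decr (l k) k.

Lemma adjacent_upper k j j' : (1 <= k < n)%N -> (1 <= j <= k)%N ->
  (1 <= j' <= k)%N -> l k j = l k j' + 1 ->
  [/\ exists2 s, (1 <= s <= k.+1)%N & l k.+1 s = l k j',
      j' = j.+1, j != i k & j != (i' k).-1].
Proof.
move=> kn jk j'k eqx.
have ltjj' : (j < j')%N.
  rewrite ltnNge; apply/negP => le_j'j.
  have := @row_decr_le (l k) k j' j; rewrite eqx => /(_ (l_decr _)).
  by lia.
have sl : (slot i i' k j < slot i i' k j')%N by apply: (slot_lt i_range); lia.
have sb := slot_bound i_range kn j'k.
have dy : row_decr (l k.+1) k.+1 by apply: l_decr; lia.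
have eqy : l k.+1 (slot i i' k j).+1 = l k j'.
  have A : l k j' <= l k.+1 (slot i i' k j).+1 by rewrite l_int //; lia.
  have B : (l k j <= l k.+1 (slot i i' k j).+1) = false by rewrite l_int //; lia.
  by lia.
have [] // := @slot_succ n i i' i_range k j j' kn; try lia.
  rewrite leqNgt; apply/negP => lts.
  have A : l k j' <= l k.+1 (slot i i' k j).+2 by rewrite l_int //; lia.
  have := @row_decr_lt _ _ (slot i i' k j).+1 (slot i i' k j).+2 dy.
  by rewrite eqy; lia.
move=> ejj' n1 n2; split=> //.
by exists (slot i i' k j).+1; lia.
Qed.

(** Interval j of row k is occupied by some z of row k-1, and x_j >= z > x_{j+1} = x_j - 1 forces z
    = x_j. *)
Lemma adjacent_lower k j : (2 <= k < n)%N -> (1 <= j < k)%N ->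
  j != i k.-1 -> j != i' k.-1 -> l k j = l k j.+1 + 1 ->
  exists2 m, (1 <= m <= k.-1)%N & l k.-1 m = l k j.
Proof.
move=> kn jk n1 n2 eqx.
have [||m mk sm] := @slot_surj n i i' i_range k.-1 j _ _ n1 n2; [lia|lia|].
exists m => //.
have k1 : k.-1.+1 = k by lia.
have A : l k.-1 m <= l k j by rewrite -{2}k1 l_int ?sm //; lia.
have B : (l k.-1 m <= l k j.+1) = false by rewrite -{2}k1 l_int ?sm //; lia.
by lia.
Qed.

Hypothesis LP : LP_condition n i i'.

(** Adjacency puts j outside {0, i_k, i'_k - 1, k}, and LP puts both empty intervals of row k-1
    inside this set. *)
Lemma adjacent_lower_LP k j j' : (1 <= k < n)%N -> (1 <= j <= k)%N ->
  (1 <= j' <= k)%N -> l k j = l k j' + 1 ->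
  exists2 m, (1 <= m <= k.-1)%N & l k.-1 m = l k j.
Proof.
move=> kn jk j'k eqx; have [_ ej n1 n2] := adjacent_upper kn jk j'k eqx.
have k2 : (2 <= k < n)%N by lia.
have [g1 g2] := LP k2.
apply: adjacent_lower => //; rewrite -?ej //; first by lia.
  by move: g1; rewrite !inE; lia.
by move: g2; rewrite !inE; lia.
Qed.

(* A simultaneous shift of two adjacent entries of row k breaks the pattern    *)
(* against row k+1 or against row k-1, whichever has not moved.                *)
Lemma adjacent_shift (l2 : nat -> nat -> int) (c : int) k j j' :
  interlacing n i i' l2 -> (c == 1) || (c == -1) ->
  (1 <= k < n)%N -> (1 <= j <= k)%N -> (1 <= j' <= k)%N ->
  l2 k j = l k j + c -> l2 k j' = l k j' + c ->
  (forall m, l2 k.+1 m = l k.+1 m) \/ (forall m, l2 k.-1 m = l k.-1 m) ->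
  l k j = l k j' + 1 -> False.
Proof.
move=> int2 c1 kn jk j'k ej ej' unmoved eqx.
case: unmoved => unm.
  have [[s sk ys] _ _ _] := adjacent_upper kn jk j'k eqx.
  have := int2 k j s kn jk sk; have := int2 k j' s kn j'k sk.
  rewrite -!l_int // ej ej' unm ys eqx; lia.
have [m mk zm] := adjacent_lower_LP kn jk j'k eqx.
have k1 : k.-1.+1 = k by lia.
have kn1 : (1 <= k.-1 < n)%N by lia.
rewrite -k1 in jk j'k.
have := int2 k.-1 m j kn1 mk jk; have := int2 k.-1 m j' kn1 mk j'k.
rewrite -!l_int // k1 ej ej' unm zm eqx; lia.
Qed.

End AdjacentEntries.

(** * Commutation identities for two unit moves *)

Section Coefficients.
Variables (F : numFieldType) (n : nat).
Implicit Types (L : tableau n) (s : step).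

Local Notation l L a b := ((entry L a b)%:~R : F).
Local Notation eps s := ((sgn s)%:~R : F).

Definition row_prod_but2 L r m m' (u : F) : F :=
  \prod_(1 <= j < r.+1 | (j != m) && (j != m')) (u - l L r j).

Lemma row_prod_but2C L r m m' (u : F) :
  row_prod_but2 L r m m' u = row_prod_but2 L r m' m u.
Proof. by apply: eq_bigl => j; rewrite andbC. Qed.

Lemma row_prod_split L r m (u : F) : (1 <= m <= r)%N ->
  row_prod L r u = (u - l L r m) * row_prod_but L r m u.
Proof.
by move=> mr; rewrite /row_prod (bigD1_seq m) ?iota_uniq // mem_index_iota ltnS.
Qed.

Lemma row_prod_but_split L r m m' (u : F) : (1 <= m' <= r)%N -> m' != m ->
  row_prod_but L r m u = (u - l L r m') * row_prod_but2 L r m m' u.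
Proof.
move=> mr mm'; rewrite /row_prod_but -big_filter (bigD1_seq m') /=; first last.
- by rewrite filter_uniq ?iota_uniq.
- by rewrite mem_filter mm' mem_index_iota ltnS.
by rewrite big_filter_cond.
Qed.

Lemma entryF_move L s a b : step_ok n s ->
  l (move L s) a b = l L a b + (if (a == srow s) && (b == scol s) then eps s else 0).
Proof. by move=> s_ok; rewrite entry_move // intrD; case: ifP. Qed.

Lemma row_prod_move_neq L s r (u : F) : step_ok n s -> r != srow s ->
  row_prod (move L s) r u = row_prod L r u.
Proof.
move=> s_ok /negbTE nr; apply: eq_bigr => j _.
by rewrite entryF_move // nr addr0.
Qed.

Lemma row_prod_but_move_neq L s r m (u : F) : step_ok n s -> r != srow s ->
  row_prod_but (move L s) r m u = row_prod_but L r m u.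
Proof.
move=> s_ok /negbTE nr; apply: eq_bigr => j _.
by rewrite entryF_move // nr addr0.
Qed.

Lemma row_prod_but_move_same L s (u : F) : step_ok n s ->
  row_prod_but (move L s) (srow s) (scol s) u = row_prod_but L (srow s) (scol s) u.
Proof.
move=> s_ok; apply: eq_bigr => j /negbTE nj.
by rewrite entryF_move // nj andbF addr0.
Qed.

Lemma row_prod_but2_move L s m (u : F) : step_ok n s ->
  row_prod_but2 (move L s) (srow s) m (scol s) u =
  row_prod_but2 L (srow s) m (scol s) u.
Proof.
move=> s_ok; apply: eq_bigr => j /andP[_ /negbTE nj].
by rewrite entryF_move // nj andbF addr0.
Qed.

Lemma row_prod_move L s (u : F) : step_ok n s ->
  row_prod (move L s) (srow s) u =
  (u - l L (srow s) (scol s) - eps s) * row_prod_but L (srow s) (scol s) u.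
Proof.
move=> s_ok; rewrite (row_prod_split _ (m := scol s)) ?row_prod_but_move_same //.
  by rewrite entryF_move // !eqxx opprD addrA.
by case/andP: s_ok.
Qed.

Lemma row_prod_but_move L s m (u : F) : step_ok n s -> scol s != m ->
  row_prod_but (move L s) (srow s) m u =
  (u - l L (srow s) (scol s) - eps s) * row_prod_but2 L (srow s) m (scol s) u.
Proof.
move=> s_ok sm; rewrite (row_prod_but_split _ (m' := scol s)) ?row_prod_but2_move //.
  by rewrite entryF_move // !eqxx opprD addrA.
by case/andP: s_ok.
Qed.

Lemma move_comm L s1 s2 : move (move L s1) s2 = move (move L s2) s1.
Proof. by apply/ffunP => p; rewrite !ffunE addrAC. Qed.

Lemma coef_move_indep L s1 s2 : step_ok n s1 -> srow s2 != srow s1 ->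
  partner s2 != srow s1 -> coef F (move L s1) s2 = coef F L s2.
Proof.
move=> s_ok r1 r2; rewrite /coef row_prod_move_neq // row_prod_but_move_neq //.
by rewrite entryF_move // (negbTE r1) addr0.
Qed.

Lemma path_coef2_indep L s1 s2 : step_ok n s1 -> step_ok n s2 ->
  srow s1 != srow s2 -> partner s1 != srow s2 -> partner s2 != srow s1 ->
  path_coef F L [:: s1; s2] = path_coef F L [:: s2; s1].
Proof.
move=> ok1 ok2 r12 p1 p2; rewrite /= !mulr1 coef_move_indep // 1?eq_sym //.
by rewrite mulrC coef_move_indep.
Qed.

(** The entries x and y interact through (x - y)(y - x - 1) = (y - x)(x - y + 1). *)
Lemma path_coef2_partners L k i j :
  step_ok n (Step k i true) -> step_ok n (Step k.+1 j false) ->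
  path_coef F L [:: Step k i true; Step k.+1 j false] =
  path_coef F L [:: Step k.+1 j false; Step k i true].
Proof.
move=> ok1 ok2; rewrite /= !mulr1 /coef /partner /=.
have n1 : (k.+1 == k) = false by lia.
have n2 : (k == k.+1) = false by lia.
have ir : (1 <= i <= k)%N by case/andP: ok1.
have jr : (1 <= j <= k.+1)%N by case/andP: ok2.
have := row_prod_but_move_neq L (r := k.+1) j _ ok1.
have := row_prod_but_move_neq L (r := k) i _ ok2.
have := fun u => row_prod_move L u ok1.
have := fun u => row_prod_move L u ok2.
rewrite /= n1 n2 => E1 E2 E3 E4.
rewrite !entryF_move //= n1 n2 /= !addr0 E1 E2 E3 // E4 //.
rewrite (row_prod_split L (l L k i) jr) (row_prod_split L (l L k.+1 j) ir).
rewrite /sgn /= !mulf_div; congr (_ / _); last by rewrite mulrC.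
by rewrite mulrNz; ring.
Qed.

(** The same identity, now in the denominators. The two denominators are equal, so the statement
    holds even where they vanish. *)
Lemma path_coef2_row L k i j : i != j ->
  step_ok n (Step k i true) -> step_ok n (Step k j false) ->
  path_coef F L [:: Step k i true; Step k j false] =
  path_coef F L [:: Step k j false; Step k i true].
Proof.
move=> ij ok1 ok2; rewrite /= !mulr1 /coef /partner /=.
have ir : (1 <= i <= k)%N by case/andP: ok1.
have jr : (1 <= j <= k)%N by case/andP: ok2.
have k0 : (k.-1 == k) = false by lia.
have k1 : (k.+1 == k) = false by lia.
have := row_prod_move_neq L (r := k.-1) _ ok1.
have := row_prod_move_neq L (r := k.+1) _ ok2.
have := fun u => row_prod_but_move L (m := j) u ok1.
have := fun u => row_prod_but_move L (m := i) u ok2.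
rewrite /= k0 k1 (eq_sym j) => E1 E2 E3 E4.
rewrite !entryF_move //= eqxx (eq_sym j) (negbTE ij) /= !addr0 E1 // E2 // E3 // E4 //.
rewrite (row_prod_but_split L (l L k i) jr) 1?eq_sym //.
rewrite (row_prod_but_split L (l L k j) ir) // (row_prod_but2C _ _ j).
rewrite !mulf_div; congr (_ / _); first by rewrite mulrC.
by rewrite /sgn /= mulrNz; ring.
Qed.

End Coefficients.

(** * Serre identities for three unit moves *)

Section SerreCoefficients.
Variables (F : numFieldType) (n : nat).
Implicit Types (L : tableau n) (s : step).

Local Notation l L a b := ((entry L a b)%:~R : F).

(** The coefficient of e_i e_j m - 2 e_i m e_j + m e_i e_j, one summand of [e, [e, m]]; for two
    different columns only the sum over both orders of [si] and [sj] vanishes. *)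
Definition serre_coef L (si sj sm : step) : F :=
  path_coef F L [:: sm; sj; si] - 2 * path_coef F L [:: sj; sm; si]
  + path_coef F L [:: sj; si; sm].

Lemma sgn_cases s : (sgn s == 1) || (sgn s == -1).
Proof. by rewrite /sgn; case: (sup s). Qed.

Section FixedSteps.
Variables (k p m : nat) (e : bool).
Let sm := Step p m e.
Let ep : F := (if e then 1 else -1)%:~R.
Hypothesis ok_m : step_ok n sm.
Hypothesis pk : p != k.
Let mp : (1 <= m <= p)%N. Proof. by case/andP: ok_m. Qed.
Let kp : k != p. Proof. by rewrite eq_sym. Qed.

Section OneStep.
Variables (j : nat).
Let sj := Step k j e.
Hypothesis ok_j : step_ok n sj.
Let jk : (1 <= j <= k)%N. Proof. by case/andP: ok_j. Qed.

(** Here the coefficient of [sj] sees row p. With d = x - y the identity is d(d - eps) - 2 d^2 + d(d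
    + eps) = 0. *)
Lemma serre_coef_diag_partner L : p = partner sj -> partner sm != k ->
  serre_coef L sj sj sm = 0.
Proof.
move=> ep_j pm; rewrite /serre_coef /= !mulr1.
have Cm L' : coef F (move L' sj) sm = coef F L' sm by apply: coef_move_indep.
rewrite !Cm /coef -ep_j /=.
have E1 L' (u : F) := row_prod_move L' u ok_m.
have E2 L' (u : F) := row_prod_move_neq L' u ok_j pk.
have E3 L' (u : F) := row_prod_but_move_neq L' j u ok_m kp.
have E4 L' (u : F) := row_prod_but_move_same L' u ok_j.
have E5 L' (u : F) := row_prod_but_move_neq L' m u ok_j pk.
move: E1 E4; rewrite /= => E1 E4.
have X1 L' : l (move L' sj) k j = l L' k j + ep.
  by rewrite entryF_move //= !eqxx.
have X2 L' : l (move L' sm) k j = l L' k j.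
  by rewrite entryF_move //= (negbTE kp) addr0.
have X3 L' : l (move L' sj) p m = l L' p m.
  by rewrite entryF_move //= (negbTE pk) addr0.
rewrite !(E1, E2, E3, E4, E5, X1, X2, X3) !(row_prod_split L _ mp).
by rewrite -/ep /sgn /= -/ep; ring.
Qed.

(** Here the coefficient of [sm] sees row k. It is affine in x, so its second difference along x, x
    + eps, x + 2 eps is 0. *)
Lemma serre_coef_diag_other L : partner sm = k -> partner sj != p -> partner sj != k ->
  serre_coef L sj sj sm = 0.
Proof.
move=> ep_m pj pj'; rewrite /serre_coef /= !mulr1.
have Cj L' : coef F (move L' sm) sj = coef F L' sj by apply: coef_move_indep.
rewrite !Cj ![_ * coef F _ sm]mulrC /coef ep_m /=.
have E1 L' (u : F) := row_prod_move L' u ok_j.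
have E2 L' (u : F) := row_prod_move_neq L' u ok_j pj'.
have E4 L' (u : F) := row_prod_but_move_same L' u ok_j.
have E5 L' (u : F) := row_prod_but_move_neq L' m u ok_j pk.
move: E1 E4; rewrite /= => E1 E4.
have X1 L' : l (move L' sj) k j = l L' k j + ep.
  by rewrite entryF_move //= !eqxx.
have X3 L' : l (move L' sj) p m = l L' p m.
  by rewrite entryF_move //= (negbTE pk) addr0.
have E6 L' (u : F) : row_prod (move L' sm) (partner sj) u = row_prod L' (partner sj) u.
  exact: row_prod_move_neq.
have E7 L' (u : F) := row_prod_but_move_neq L' j u ok_m kp.
have X2 L' : l (move L' sm) k j = l L' k j.
  by rewrite entryF_move //= (negbTE kp) addr0.
rewrite !(E1, E2, E4, E5, E6, E7, X1, X2, X3) !(row_prod_split L _ jk).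
by rewrite -/ep /sgn /= -/ep; ring.
Qed.

End OneStep.

Section TwoSteps.
Variables (i j : nat).
Let si := Step k i e.
Let sj := Step k j e.
Hypotheses (ok_i : step_ok n si) (ok_j : step_ok n sj) (ij : i != j).
Let ik : (1 <= i <= k)%N. Proof. by case/andP: ok_i. Qed.
Let jk : (1 <= j <= k)%N. Proof. by case/andP: ok_j. Qed.
Let ji : j != i. Proof. by rewrite eq_sym. Qed.

(** The two orders of moving x_i and x_j have the denominators (x_j - x_i)(x_i - x_j - eps) and (x_i
    - x_j)(x_j - x_i - eps). The identity needs them nonzero, which is where adjacency must be
    excluded. *)
Lemma serre_coef_partner L : p = partner sj -> partner sm != k ->
  l L k i != l L k j -> l L k i != l L k j + ep -> l L k j != l L k i + ep ->
  serre_coef L si sj sm + serre_coef L sj si sm = 0.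
Proof.
move=> ep_j pm d0 d1 d2; rewrite /serre_coef /= !mulr1.
have Cm1 L' : coef F (move L' si) sm = coef F L' sm by apply: coef_move_indep.
have Cm2 L' : coef F (move L' sj) sm = coef F L' sm by apply: coef_move_indep.
rewrite !(Cm1, Cm2).
have ep_i : p = partner si by [].
move: (coef F L sm) => C; rewrite /coef -ep_j -ep_i /=.
have E1 L' (u : F) := row_prod_move L' u ok_m.
have E2 L' (u : F) := row_prod_move_neq L' u ok_j pk.
have E2' L' (u : F) := row_prod_move_neq L' u ok_i pk.
have E3 L' x (u : F) := row_prod_but_move_neq L' x u ok_m kp.
have E4 L' (u : F) := row_prod_but_move L' u ok_j ji.
have E4' L' (u : F) := row_prod_but_move L' u ok_i ij.
have E5 L' (u : F) := row_prod_but_move_neq L' m u ok_j pk.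
have E5' L' (u : F) := row_prod_but_move_neq L' m u ok_i pk.
have E6 L' a b (u : F) : row_prod_but2 (move L' sm) k a b u = row_prod_but2 L' k a b u.
  by apply: eq_bigr => t _; rewrite entryF_move //= (negbTE kp) addr0.
move: E1 E4 E4'; rewrite /= => E1 E4 E4'.
have X1 L' : l (move L' sj) k i = l L' k i.
  by rewrite entryF_move //= (negbTE ij) andbF addr0.
have X1' L' : l (move L' si) k j = l L' k j.
  by rewrite entryF_move //= (negbTE ji) andbF addr0.
have X2 L' x : l (move L' sm) k x = l L' k x.
  by rewrite entryF_move //= (negbTE kp) addr0.
have X3 L' : l (move L' sj) p m = l L' p m.
  by rewrite entryF_move //= (negbTE pk) addr0.
have X3' L' : l (move L' si) p m = l L' p m.
  by rewrite entryF_move //= (negbTE pk) addr0.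
rewrite !(E1, E2, E2', E3, E4, E4', E5, E5', E6, X1, X1', X2, X3, X3').
rewrite !(row_prod_split L _ mp) !(row_prod_but_split L _ jk ji).
rewrite !(row_prod_but_split L _ ik ij) !(row_prod_but2C L k j i) /sgn /= -/ep.
move: (row_prod_but2 L k i j (l L k i)) (row_prod_but2 L k i j (l L k j)) => Qi Qj.
move: (row_prod_but L p m (l L k i)) (row_prod_but L p m (l L k j)) => Pi Pj.
move: (l L k i) (l L k j) (l L p m) d0 d1 d2 => xi xj y d0 d1 d2.
rewrite !invfM; move: (Qi^-1) (Qj^-1) => qi qj; field.
move: d1 d2; rewrite /ep => d1 d2.
have d0' : xj - xi != 0 by rewrite subr_eq0 eq_sym.
by rewrite d0' !subr_eq0 d0 !subr_eq ![_ + xi]addrC ![_ + xj]addrC d1 d2.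
Qed.

Lemma serre_coef_other L : partner sm = k -> partner sj != p -> partner sj != k ->
  l L k i != l L k j -> l L k i != l L k j + ep -> l L k j != l L k i + ep ->
  serre_coef L si sj sm + serre_coef L sj si sm = 0.
Proof.
move=> ep_m pj pj' d0 d1 d2; rewrite /serre_coef /= !mulr1.
have pi : partner si != p by [].
have pi' : partner si != k by [].
have C1 L' : coef F (move L' sm) si = coef F L' si by apply: coef_move_indep.
have C2 L' : coef F (move L' sm) sj = coef F L' sj by apply: coef_move_indep.
rewrite !(C1, C2) /coef ep_m /=.
have epE : partner si = partner sj by [].
rewrite epE; move: pj pj'; move: (partner sj) => r rp rk.
have E1 L' (u : F) := row_prod_move L' u ok_j.
have E1' L' (u : F) := row_prod_move L' u ok_i.
have E2 L' (u : F) := row_prod_move_neq L' u ok_j rk.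
have E2' L' (u : F) := row_prod_move_neq L' u ok_i rk.
have E3 L' (u : F) := row_prod_move_neq L' u ok_m rp.
have E4 L' (u : F) := row_prod_but_move L' u ok_j ji.
have E4' L' (u : F) := row_prod_but_move L' u ok_i ij.
have E5 L' (u : F) := row_prod_but_move_neq L' m u ok_j pk.
have E5' L' (u : F) := row_prod_but_move_neq L' m u ok_i pk.
have E6 L' x (u : F) := row_prod_but_move_neq L' x u ok_m kp.
have E7 L' a b (u : F) : row_prod_but2 (move L' sm) k a b u = row_prod_but2 L' k a b u.
  by apply: eq_bigr => t _; rewrite entryF_move //= (negbTE kp) addr0.
move: E1 E1' E4 E4'; rewrite /= => E1 E1' E4 E4'.
have X1 L' : l (move L' sj) k i = l L' k i.
  by rewrite entryF_move //= (negbTE ij) andbF addr0.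
have X1' L' : l (move L' si) k j = l L' k j.
  by rewrite entryF_move //= (negbTE ji) andbF addr0.
have X2 L' x : l (move L' sm) k x = l L' k x.
  by rewrite entryF_move //= (negbTE kp) addr0.
have X3 L' : l (move L' sj) p m = l L' p m.
  by rewrite entryF_move //= (negbTE pk) addr0.
have X3' L' : l (move L' si) p m = l L' p m.
  by rewrite entryF_move //= (negbTE pk) addr0.
rewrite !(E1, E1', E2, E2', E3, E4, E4', E5, E5', E6, E7, X1, X1', X2, X3, X3').
rewrite !(row_prod_split L _ ik) !(row_prod_but_split L _ jk ji).
rewrite !(row_prod_but_split L _ ik ij) !(row_prod_but2C L k j i) /sgn /= -/ep.
move: (row_prod_but2 L k i j (l L k i)) (row_prod_but2 L k i j (l L k j)) => Qi Qj.
move: (row_prod_but2 L k i j (l L p m)) (row_prod_but L p m (l L p m)) => R S.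
move: (row_prod L r (l L k i)) (row_prod L r (l L k j)) => Pi Pj.
move: (l L k i) (l L k j) (l L p m) d0 d1 d2 => xi xj y d0 d1 d2.
rewrite !invfM; move: (Qi^-1) (Qj^-1) (S^-1) => qi qj q; field.
move: d1 d2; rewrite /ep => d1 d2.
have d0' : xj - xi != 0 by rewrite subr_eq0 eq_sym.
by rewrite d0' !subr_eq0 d0 !subr_eq ![_ + xi]addrC ![_ + xj]addrC d1 d2.
Qed.

End TwoSteps.
End FixedSteps.
End SerreCoefficients.

(** * The module structure under the LP-condition *)

Section RowOperators.
Variables (F : numFieldType) (n : nat) (K : choiceType).
Variables (tab : K -> tableau n) (T : tableau n -> {malg F[K]}).
Variable op : step -> K -> {malg F[K]}.
Local Notation A := (K -> {malg F[K]}).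
Local Notation l L a b := ((entry L a b)%:~R : F).

Hypothesis op_wordE : forall w b, all (step_ok n) w ->
  op_word op w b = path_coef F (tab b) w *: T (foldl (@move n) (tab b) w).

Definition row_op (k : nat) (e : bool) : A :=
  \sum_(m <- index_iota 1 k.+1) op (Step k m e).

Lemma sum_app (I : Type) (r : seq I) (P : pred I) (f : I -> A) b :
  (\sum_(x <- r | P x) f x) b = \sum_(x <- r | P x) f x b.
Proof. by apply: (big_morph (fun g : A => g b)). Qed.

Lemma op_mul_sum3 (r1 r2 r3 : seq nat) (f g h : nat -> A) :
  op_mul (\sum_(a <- r1) f a) (op_mul (\sum_(c <- r2) g c) (\sum_(m <- r3) h m)) =
  \sum_(a <- r1) \sum_(c <- r2) \sum_(m <- r3)
    op_mul (f a) (op_mul (g c) (h m)).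
Proof.
rewrite op_mul_suml; apply: eq_bigr => a _.
rewrite op_mul_suml op_mul_sumr; apply: eq_bigr => c _.
by rewrite !op_mul_sumr.
Qed.

Lemma step_ok_row k m e : (1 <= k < n)%N -> m \in index_iota 1 k.+1 ->
  step_ok n (Step k m e).
Proof. by rewrite mem_index_iota /step_ok /=; lia. Qed.

Lemma op_comm s1 s2 : step_ok n s1 -> step_ok n s2 ->
  (forall L : tableau n, path_coef F L [:: s1; s2] = path_coef F L [:: s2; s1]) ->
  op_mul (op s1) (op s2) = op_mul (op s2) (op s1).
Proof.
move=> ok1 ok2 H.
have ok12 : all (step_ok n) [:: s1; s2] by rewrite /= ok1 ok2.
have ok21 : all (step_ok n) [:: s2; s1] by rewrite /= ok1 ok2.
rewrite !op_word2.
apply: funext => b; rewrite (op_wordE _ ok21) (op_wordE _ ok12) H.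
by congr (_ *: T _); exact: move_comm.
Qed.

Lemma row_op_comm k e p f : (1 <= k < n)%N -> (1 <= p < n)%N ->
  (forall a b (L : tableau n), step_ok n (Step k a e) -> step_ok n (Step p b f) ->
    path_coef F L [:: Step k a e; Step p b f] =
    path_coef F L [:: Step p b f; Step k a e]) ->
  op_br (row_op k e) (row_op p f) = 0.
Proof.
move=> kn pn H; rewrite /op_br /row_op.
rewrite op_mul_suml [X in _ - X]op_mul_sumr -sumrB big_seq big1 // => a ak.
rewrite op_mul_sumr op_mul_suml -sumrB big_seq big1 // => c cp.
have oka := step_ok_row e kn ak; have okc := step_ok_row f pn cp.
by rewrite (op_comm oka okc) ?subrr // => L; apply: H.
Qed.

Lemma row_op_comm_far k e p f : (1 <= k < n)%N -> (1 <= p < n)%N ->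
  (k.+1 < p)%N || (p.+1 < k)%N -> op_br (row_op k e) (row_op p f) = 0.
Proof.
move=> kn pn kp; apply: row_op_comm => // a b L oka okb.
by apply: path_coef2_indep => //; rewrite /partner /=; case: e oka; case: f okb; lia.
Qed.

Lemma row_op_comm_raise_lower k p : (1 <= k < n)%N -> (1 <= p < n)%N -> k != p ->
  op_br (row_op k true) (row_op p false) = 0.
Proof.
move=> kn pn kp; have [epk|npk] := eqVneq p k.+1.
  by subst p; apply: row_op_comm => // a b L; exact: path_coef2_partners.
apply: row_op_comm => // a b L oka okb.
by apply: path_coef2_indep => //; rewrite /partner /=; lia.
Qed.

Section Serre.
Variables (i i' : nat -> nat).
Hypothesis i_range : forall k : nat, (1 <= k < n)%N ->
  [/\ (i k <= k)%N, (1 <= i' k <= k.+1)%N & (i k < i' k)%N].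
Hypothesis tab_int : forall b, interlacing n i i' (entry (tab b)).
Hypothesis tab_decr : forall b k, (1 <= k <= n)%N -> row_decr (entry (tab b) k) k.
Hypothesis T_out : forall L, ~ interlacing n i i' (entry L) -> T L = 0.
Hypothesis LP : LP_condition n i i'.
Variables (k p : nat) (e : bool).
Hypotheses (kn : (1 <= k < n)%N) (pn : (1 <= p < n)%N).
Hypothesis kp : p = k.+1 \/ k = p.+1.

Let serre_term (a c m : nat) : A :=
  op_mul (op (Step k a e)) (op_mul (op (Step k c e)) (op (Step p m e)))
  - op_mul (op (Step k a e)) (op_mul (op (Step p m e)) (op (Step k c e))) *+ 2
  + op_mul (op (Step p m e)) (op_mul (op (Step k a e)) (op (Step k c e))).

Lemma serre_term_eval a c m (b : K) : step_ok n (Step k a e) ->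
  step_ok n (Step k c e) -> step_ok n (Step p m e) ->
  serre_term a c m b =
  serre_coef F (tab b) (Step k a e) (Step k c e) (Step p m e)
  *: T (move (move (move (tab b) (Step k a e)) (Step k c e)) (Step p m e)).
Proof.
move=> oka okc okm; rewrite /serre_term !op_word3.
have aE (u v : A) x : (u + v) x = u x + v x by [].
have nE (u : A) x : (- u) x = - u x by [].
rewrite !aE nE mulr2n aE.
have ok1 : all (step_ok n) [:: Step p m e; Step k c e; Step k a e].
  by rewrite /= okm okc oka.
have ok2 : all (step_ok n) [:: Step k c e; Step p m e; Step k a e].
  by rewrite /= okm okc oka.
have ok3 : all (step_ok n) [:: Step k c e; Step k a e; Step p m e].
  by rewrite /= okm okc oka.
rewrite (op_wordE _ ok1) (op_wordE _ ok2) (op_wordE _ ok3).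
rewrite /serre_coef.
have f1 : foldl (@move n) (tab b) [:: Step p m e; Step k c e; Step k a e] =
   foldl (@move n) (tab b) [:: Step k c e; Step k a e; Step p m e].
  rewrite /= (move_comm (tab b)) (move_comm (move (tab b) _)) //.
have f2 : foldl (@move n) (tab b) [:: Step k c e; Step p m e; Step k a e] =
   foldl (@move n) (tab b) [:: Step k c e; Step k a e; Step p m e].
  by rewrite /= (move_comm (move (tab b) _)).
have f3 : move (move (move (tab b) (Step k a e)) (Step k c e)) (Step p m e) =
   foldl (@move n) (tab b) [:: Step k c e; Step k a e; Step p m e].
  by rewrite /= (move_comm (tab b)).
rewrite f1 f2 f3; move: (path_coef _ _ _) (path_coef _ _ _) (path_coef _ _ _) => x y z.
by rewrite -scalerDl -scalerBl -scalerDl mulr2n mulrDl mul1r.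
Qed.

(** If the target tableau is interlacing, [adjacent_shift] shows that the two moved entries are not
    adjacent, so the identities for three moves apply; otherwise T of the target is 0. *)
Lemma serre_term_sym a c m : step_ok n (Step k a e) ->
  step_ok n (Step k c e) -> step_ok n (Step p m e) ->
  serre_term a c m + serre_term c a m = 0.
Proof.
move=> oka okc okm; apply: funext => b.
have aE (u v : A) x : (u + v) x = u x + v x by [].
rewrite aE !serre_term_eval // (move_comm (tab b) (Step k c e)) -scalerDl.
set L2 := move _ _; set co := _ + _.
have [int2|nint2] := pselect (interlacing n i i' (entry L2)); last first.
  by rewrite T_out // scaler0.
suff -> : co = 0 by rewrite scale0r.
have pk : p != k by case: kp => ->; lia.
have [eac|ac] := eqVneq a c.
  suff e0 : serre_coef F (tab b) (Step k a e) (Step k a e) (Step p m e) = 0.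
    by rewrite /co -eac e0 addr0.
  have [pE|pE] := boolP (p == partner (Step k a e)).
    apply: serre_coef_diag_partner => //; first exact/eqP.
    by move: pE; rewrite /partner /=; case: (e); lia.
  apply: serre_coef_diag_other => //; rewrite /partner /=.
  - by move: pE; rewrite /partner /=; case: (e); lia.
  - by move: pE; rewrite /partner /=; case: (e); lia.
  - by case: (e); lia.
have ar : (1 <= a <= k)%N by case/andP: oka.
have cr : (1 <= c <= k)%N by case/andP: okc.
have xL2 t : ((t == a) || (t == c))%N ->
    entry L2 k t = entry (tab b) k t + sgn (Step k a e).
  rewrite /L2 !entry_move //= !eqxx (eq_sym k) (negbTE pk) /= addr0.
  by case/orP=> /eqP->; rewrite eqxx ?(negbTE ac) ?(eq_sym c) ?(negbTE ac) ?addr0.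
(* Row p is one neighbour of row k; the other neighbour stays fixed. *)
have unmoved : (forall t, entry L2 k.+1 t = entry (tab b) k.+1 t) \/
    (forall t, entry L2 k.-1 t = entry (tab b) k.-1 t).
  have k1 : (k.+1 == k) = false by lia.
  have k2 : (k.-1 == k) = false by lia.
  case: kp => pE; [right|left] => t; rewrite /L2 !entry_move //= ?k1 ?k2 /= !addr0.
    by have -> /= : (k.-1 == p) = false; [lia | rewrite addr0].
  by have -> /= : (k.+1 == p) = false; [lia | rewrite addr0].
have gap x y : ((x == a) && (y == c)) || ((x == c) && (y == a)) ->
    entry (tab b) k x <> entry (tab b) k y + 1.
  move=> xy; apply: (adjacent_shift i_range (tab_int b) (@tab_decr b) LP int2
    (sgn_cases (Step k a e)) kn _ _ _ _ unmoved).
  - by case/orP: xy => /andP[/eqP-> _].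
  - by case/orP: xy => /andP[_ /eqP->].
  - by apply: xL2; case/orP: xy => /andP[-> _]; rewrite ?orbT.
  - by apply: xL2; case/orP: xy => /andP[_ ->]; rewrite ?orbT.
have g1 := gap a c; have g2 := gap c a; rewrite !eqxx ?orbT in g1 g2.
have {}g1 := g1 isT; have {}g2 := g2 isT.
have d0 : l (tab b) k a != l (tab b) k c.
  rewrite eqr_int; apply/eqP => eac.
  have dk : row_decr (entry (tab b) k) k by apply: tab_decr; lia.
  by case: (ltngtP a c) ac => // lt _; have := row_decr_lt dk _ lt; rewrite eac; lia.
have ep1 : (if e then 1 else -1 : int) = 1 \/ (if e then 1 else -1 : int) = -1.
  by case: (e); [left|right].
have d1 : l (tab b) k a != l (tab b) k c + (if e then 1 else -1)%:~R.
  by rewrite -intrD eqr_int; case: ep1 => ->; lia.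
have d2 : l (tab b) k c != l (tab b) k a + (if e then 1 else -1)%:~R.
  by rewrite -intrD eqr_int; case: ep1 => ->; lia.
have [pE|pE] := boolP (p == partner (Step k a e)).
  apply: serre_coef_partner => //; first exact/eqP.
  by move: pE; rewrite /partner /=; case: (e); lia.
apply: serre_coef_other => //; rewrite /partner /=.
- by move: pE; rewrite /partner /=; case: (e); lia.
- by move: pE; rewrite /partner /=; case: (e); lia.
- by case: (e); lia.
Qed.

Lemma row_op_serre :
  op_br (row_op k e) (op_br (row_op k e) (row_op p e)) = 0.
Proof.
have tf2 (x : A) : x + x = 0 -> x = 0.
  move=> /eqP; rewrite -mulr2n -scaler_nat scaler_eq0 pnatr_eq0 /=.
  by move/eqP.
(* The sum is doubled so that the copy with a and c exchanged can be added term by term. *)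
apply: tf2.
have -> : op_br (row_op k e) (op_br (row_op k e) (row_op p e)) =
    \sum_(a <- index_iota 1 k.+1) \sum_(c <- index_iota 1 k.+1)
    \sum_(m <- index_iota 1 p.+1) serre_term a c m.
  pose R := index_iota 1 k.+1; pose S := index_iota 1 p.+1.
  have e1 : op_mul (row_op k e) (op_mul (row_op k e) (row_op p e)) =
      \sum_(a <- R) \sum_(c <- R) \sum_(m <- S)
      op_mul (op (Step k a e)) (op_mul (op (Step k c e)) (op (Step p m e))).
    exact: op_mul_sum3.
  have e2 : op_mul (row_op k e) (op_mul (row_op p e) (row_op k e)) =
      \sum_(a <- R) \sum_(c <- R) \sum_(m <- S)
      op_mul (op (Step k a e)) (op_mul (op (Step p m e)) (op (Step k c e))).
    by rewrite op_mul_sum3; apply: eq_bigr => a _; rewrite exchange_big.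
  have e3 : op_mul (row_op p e) (op_mul (row_op k e) (row_op k e)) =
      \sum_(a <- R) \sum_(c <- R) \sum_(m <- S)
      op_mul (op (Step p m e)) (op_mul (op (Step k a e)) (op (Step k c e))).
    rewrite op_mul_sum3 exchange_big; apply: eq_bigr => a _.
    by rewrite exchange_big.
  rewrite /op_br op_mulBr op_mulBl -!op_mulA e1 e2 e3.
  have zE (W : zmodType) (x y z : W) : x - y - (y - z) = x - y *+ 2 + z.
    by rewrite opprB [z - y]addrC addrA mulr2n opprD addrA.
  rewrite zE -sumrMnl -sumrB -big_split; apply: eq_bigr => a _ /=.
  rewrite -sumrMnl -sumrB -big_split; apply: eq_bigr => c _ /=.
  by rewrite -sumrMnl -sumrB -big_split.
rewrite {2}exchange_big -big_split big_seq big1 // => a ak /=.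
rewrite -big_split big_seq big1 // => c ck /=.
rewrite -big_split big_seq big1 // => m mp /=.
by apply: serre_term_sym; exact: step_ok_row.
Qed.

End Serre.
End RowOperators.

(** * The commutator of E_{k,k+1} and E_{k+1,k} as a sum of residues *)

Section RowSequences.
Variables (F : numFieldType) (n : nat).
Implicit Types (L : tableau n) (s : step).
Local Notation l L a b := ((entry L a b)%:~R : F).
Local Notation eps s := ((sgn s)%:~R : F).

Definition row_seq L r : seq F := [seq l L r j | j <- index_iota 1 r.+1].

Definition row_sum L r : F := \sum_(1 <= j < r.+1) l L r j.

Definition weight L a : F := a.-1%:R + row_sum L a - row_sum L a.-1.

Lemma row_sum_move L s r : step_ok n s ->
  row_sum (move L s) r = row_sum L r + eps s *+ (r == srow s).
Proof.
move=> s_ok; rewrite /row_sum.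
under eq_bigr do rewrite entryF_move //.
rewrite big_split /=; congr (_ + _).
have [->|_] := eqVneq r (srow s); last by rewrite big1.
rewrite (bigD1_seq (scol s)) ?iota_uniq //=; last first.
  by rewrite mem_index_iota ltnS; case/andP: s_ok.
by rewrite !eqxx big1 ?addr0 // => j /negbTE->.
Qed.

Lemma weight_move L s a : (1 <= a)%N -> step_ok n s ->
  weight (move L s) a =
  weight L a + (eps s *+ (a == srow s) - eps s *+ (a == (srow s).+1)).
Proof.
move=> a1 s_ok; rewrite /weight !row_sum_move //.
have -> : (a.-1 == srow s) = (a == (srow s).+1) by lia.
move: (eps s *+ _) (eps s *+ _) => x y; ring.
Qed.

Lemma weight_sub L k : (1 <= k)%N -> weight L k - weight L k.+1 =
  2 * row_sum L k - row_sum L k.+1 - row_sum L k.-1 - 1.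
Proof.
case: k => // k _; rewrite /weight /= -natr1; ring.
Qed.

Lemma mem_row_seq L r x :
  reflect (exists2 j, (1 <= j <= r)%N & x = l L r j) (x \in row_seq L r).
Proof.
apply: (iffP mapP) => [[j]|[j jr ->]].
  by rewrite mem_index_iota ltnS => jr ->; exists j.
by exists j => //; rewrite mem_index_iota ltnS.
Qed.

Lemma size_row_seq L r : size (row_seq L r) = r.
Proof. by rewrite size_map size_iota subn1. Qed.

Section Decreasing.
Variables (L : tableau n) (r : nat).
Hypothesis decr : row_decr (entry L r) r.

Lemma row_entry_inj a b : (1 <= a <= r)%N -> (1 <= b <= r)%N ->
  (l L r a == l L r b) = (a == b).
Proof.
move=> ar br; rewrite eqr_int; case: (ltngtP a b) => [ab|ba|->]; last by rewrite eqxx.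
  by have := row_decr_lt decr _ ab; lia.
by have := row_decr_lt decr _ ba; lia.
Qed.

Lemma row_seq_uniq : uniq (row_seq L r).
Proof.
rewrite map_inj_in_uniq ?iota_uniq // => a b; rewrite !mem_index_iota !ltnS => ar br.
by move/eqP; rewrite row_entry_inj // => /eqP.
Qed.

Lemma prod_row_seq_but m (u : F) : (1 <= m <= r)%N ->
  \prod_(x <- row_seq L r | x != l L r m) (u - x) = row_prod_but L r m u.
Proof.
move=> mr; rewrite big_map big_seq_cond [RHS]big_seq_cond.
apply: eq_bigl => j; rewrite mem_index_iota ltnS.
by case: (boolP (_ <= _ <= _)%N) => //= jr; rewrite row_entry_inj.
Qed.

End Decreasing.

Lemma prod_row_seq L r (u : F) : \prod_(x <- row_seq L r) (u - x) = row_prod L r u.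
Proof. by rewrite big_map. Qed.

Lemma sum_row_seq L r : \sum_(x <- row_seq L r) x = row_sum L r.
Proof. by rewrite big_map. Qed.

(** The defect of [E_{k,k+1}, E_{k+1,k}] = E_kk - E_{k+1,k+1} at T(L). *)
Definition double_residues L k : F :=
  \sum_(t <- doubles (row_seq L k))
    reduced_residue (row_seq L k) (row_seq L k.+1) (row_seq L k.-1) t.

Lemma raise_lower_path_coef L k m : (1 <= k < n)%N -> (1 <= m <= k)%N ->
  row_decr (entry L k) k ->
  path_coef F L [:: Step k m true; Step k m false] =
  raise_lower_term (row_seq L k) (row_seq L k.+1) (row_seq L k.-1) (l L k m).
Proof.
move=> kn mk decr; rewrite /= mulr1 /raise_lower_term.
rewrite !prod_row_seq !(prod_row_seq_but decr) //.
have ok : step_ok n (Step k m true) by rewrite /step_ok /=; lia.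
have k1 : k.-1 != srow (Step k m true) by rewrite /=; lia.
rewrite /coef /partner /= (row_prod_move_neq _ _ ok k1).
have := row_prod_but_move_same (F := F) L _ ok; rewrite /= => ->.
by rewrite entryF_move //= !eqxx /sgn.
Qed.

Lemma lower_raise_path_coef L k m : (1 <= k < n)%N -> (1 <= m <= k)%N ->
  row_decr (entry L k) k ->
  path_coef F L [:: Step k m false; Step k m true] =
  lower_raise_term (row_seq L k) (row_seq L k.+1) (row_seq L k.-1) (l L k m).
Proof.
move=> kn mk decr; rewrite /= mulr1 /lower_raise_term.
rewrite !prod_row_seq !(prod_row_seq_but decr) //.
have ok : step_ok n (Step k m false) by rewrite /step_ok /=; lia.
have k1 : k.+1 != srow (Step k m false) by rewrite /=; lia.
rewrite /coef /partner /= (row_prod_move_neq _ _ ok k1).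
have := row_prod_but_move_same (F := F) L _ ok; rewrite /= => ->.
by rewrite entryF_move //= !eqxx /sgn /= mulrNz.
Qed.

Lemma sum_path_coef_commutator L k : (1 <= k < n)%N ->
  row_decr (entry L k) k -> row_decr (entry L k.+1) k.+1 ->
  {subset doubles (row_seq L k) <= row_seq L k.+1} ->
  \sum_(m <- index_iota 1 k.+1)
     (path_coef F L [:: Step k m true; Step k m false]
      - path_coef F L [:: Step k m false; Step k m true])
  = weight L k - weight L k.+1 - double_residues L k.
Proof.
move=> kn dx dy sD; have k1 : (1 <= k)%N by lia.
have szY : size (row_seq L k.+1) = (size (row_seq L k)).+1 by rewrite !size_row_seq.
have szZ : (size (row_seq L k.-1)).+1 = size (row_seq L k).
  by rewrite !size_row_seq prednK.
have := sum_terms_reduced_residue (row_seq_uniq dx) (row_seq_uniq dy) sD szY szZ.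
rewrite !sum_row_seq weight_sub // -/(double_residues L k) => <-.
rewrite -sumrB big_map; apply: eq_big_seq => m; rewrite mem_index_iota ltnS => mk.
by rewrite raise_lower_path_coef // lower_raise_path_coef.
Qed.

End RowSequences.

Section Generators.
Variables (F : numFieldType) (n : nat) (K : choiceType).
Variables (tab : K -> tableau n) (T : tableau n -> {malg F[K]}).
Variable op : step -> K -> {malg F[K]}.
Local Notation A := (K -> {malg F[K]}).
Local Notation eps s := ((sgn s)%:~R : F).

Hypothesis op_wordE : forall w b, all (step_ok n) w ->
  op_word op w b = path_coef F (tab b) w *: T (foldl (@move n) (tab b) w).
Hypothesis T_tab : forall b, T (tab b) = << b >>.
Hypothesis T_cases : forall L, T L = 0 \/ exists b, L = tab b.

Definition diag_op (a : nat) : A := fun b => weight F (tab b) a *: << b >>.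

Lemma opE s b : step_ok n s -> op s b = coef F (tab b) s *: T (move (tab b) s).
Proof. by move=> ok; rewrite op_word1 op_wordE /= ?ok // mulr1. Qed.

Lemma lin_ext_diag a L : lin_ext (diag_op a) (T L) = weight F L a *: T L.
Proof.
have [->|[b ->]] := T_cases L; first by rewrite lin_ext0 scaler0.
by rewrite T_tab lin_ext_basis.
Qed.

Lemma diag_br_diag a c : op_br (diag_op a) (diag_op c) = 0.
Proof.
apply/eqP; rewrite subr_eq0; apply/eqP; apply: funext => b.
by rewrite /op_mul /diag_op !lin_extZ !lin_ext_basis !scalerA mulrC.
Qed.

Lemma diag_br_op a s : (1 <= a)%N -> step_ok n s ->
  op_br (diag_op a) (op s) =
  (eps s *+ (a == srow s) - eps s *+ (a == (srow s).+1)) *: op s.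
Proof.
move=> a1 ok; rewrite /op_br; apply: funext => b.
have aE (u v : A) x : (u - v) x = u x - v x by [].
have sE c (u : A) x : (c *: u) x = c *: u x by [].
rewrite aE sE /op_mul /diag_op lin_extZ lin_ext_basis -/(diag_op a) opE //.
rewrite lin_extZ lin_ext_diag weight_move //.
by rewrite !scalerA -scalerBl; congr (_ *: _); ring.
Qed.

Lemma diag_br_row a k e : (1 <= a)%N -> (1 <= k < n)%N ->
  op_br (diag_op a) (row_op op k e) =
  ((if e then 1 else -1) *+ (a == k) - (if e then 1 else -1) *+ (a == k.+1))
  *: row_op op k e.
Proof.
move=> a1 kn; rewrite /op_br /row_op op_mul_sumr op_mul_suml -sumrB scaler_sumr.
apply: eq_big_seq => m mk; have ok := step_ok_row e kn mk.
have := diag_br_op a1 ok; rewrite /op_br => ->; rewrite /sgn /=.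
by case: e {ok}; rewrite ?mulrNz.
Qed.

Section Commutator.
Variables (i i' : nat -> nat).
Hypothesis i_range : forall k : nat, (1 <= k < n)%N ->
  [/\ (i k <= k)%N, (1 <= i' k <= k.+1)%N & (i k < i' k)%N].
Hypothesis tab_int : forall b, interlacing n i i' (entry (tab b)).
Hypothesis tab_decr : forall b k, (1 <= k <= n)%N -> row_decr (entry (tab b) k) k.

Lemma doubles_sub k b : (1 <= k < n)%N ->
  {subset doubles (row_seq F (tab b) k) <= row_seq F (tab b) k.+1}.
Proof.
move=> kn t; rewrite mem_doubles => /andP[/mem_row_seq[j' j'k ->]].
case/mem_row_seq=> j jk /eqP; rewrite -(intrD _ _ 1) eqr_int => /eqP/esym eqx.
have [[s sk ys] _ _ _] := adjacent_upper i_range (tab_int b) (@tab_decr b) kn jk j'k eqx.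
by apply/mem_row_seq; exists s => //; rewrite ys.
Qed.

(** Moves of different columns commute by [path_coef2_row], so only closed paths remain, and these
    are summed by [sum_path_coef_commutator]. *)
Lemma row_commutator k b : (1 <= k < n)%N ->
  (op_mul (row_op op k false) (row_op op k true)
   - op_mul (row_op op k true) (row_op op k false)) b =
  (weight F (tab b) k - weight F (tab b) k.+1 - double_residues F (tab b) k) *: << b >>.
Proof.
move=> kn.
have dx : row_decr (entry (tab b) k) k by apply: tab_decr; lia.
have dy : row_decr (entry (tab b) k.+1) k.+1 by apply: tab_decr; lia.
rewrite -(sum_path_coef_commutator kn dx dy (@doubles_sub k b kn)).
have -> : op_mul (row_op op k false) (row_op op k true)
   - op_mul (row_op op k true) (row_op op k false) =
   \sum_(m <- index_iota 1 k.+1)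
     (op_mul (op (Step k m false)) (op (Step k m true))
      - op_mul (op (Step k m true)) (op (Step k m false))).
  rewrite [in X in X - _]/row_op [in X in _ - X]/row_op.
  rewrite op_mul_suml [X in _ - X]op_mul_sumr -sumrB; apply: eq_big_seq => c ck.
  rewrite op_mul_sumr op_mul_suml -sumrB (bigD1_seq c) ?iota_uniq //=.
  rewrite big_seq_cond big1 ?addr0 // => a /andP[ak ac].
  have oka := step_ok_row true kn ak; have okc := step_ok_row false kn ck.
  rewrite (op_comm op_wordE oka okc) ?subrr // => L.
  by apply: path_coef2_row.
rewrite sum_app scaler_suml; apply: eq_big_seq => m mk.
have okt := step_ok_row true kn mk; have okf := step_ok_row false kn mk.
have aE (u v : A) x : (u - v) x = u x - v x by [].
have ok1 : all (step_ok n) [:: Step k m true; Step k m false] by rewrite /= okt okf.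
have ok2 : all (step_ok n) [:: Step k m false; Step k m true] by rewrite /= okt okf.
rewrite aE !op_word2 (op_wordE _ ok1) (op_wordE _ ok2).
have back e : move (move (tab b) (Step k m e)) (Step k m (~~ e)) = tab b.
  apply/ffunP => p; rewrite !ffunE /sgn /=.
  by case: ifP; case: (e); rewrite /= -!addrA ?addr0 ?addrN ?addNr ?addr0.
have b1 : foldl (@move n) (tab b) [:: Step k m true; Step k m false] = tab b.
  exact: (back true).
have b2 : foldl (@move n) (tab b) [:: Step k m false; Step k m true] = tab b.
  exact: (back false).
by rewrite b1 b2 T_tab scalerBl.
Qed.

Lemma commutator_double_residues k b : (1 <= k < n)%N ->
  op_mul (- row_op op k true) (row_op op k false)
  - op_mul (row_op op k false) (- row_op op k true) = diag_op k - diag_op k.+1 ->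
  double_residues F (tab b) k = 0.
Proof.
move=> kn; rewrite op_mulNl op_mulNr opprK addrC => e0.
have := row_commutator b kn; rewrite e0.
have -> : (diag_op k - diag_op k.+1) b =
    (weight F (tab b) k - weight F (tab b) k.+1) *: << b >> by rewrite scalerBl.
move/eqP; rewrite -subr_eq0 -scalerBl subKr.
move/eqP/(congr1 (mcoeff b)); by rewrite mcoeffZ mcoeffUU mulr1 mcoeff0.
Qed.

Hypothesis LP : LP_condition n i i'.

(** At a double pole t = x_{j'} the number t + 1 = x_j occurs in row k-1, so the factor prod_Z (t +
    1 - z) is 0. *)
Lemma double_residues_LP k b : (1 <= k < n)%N -> double_residues F (tab b) k = 0.
Proof.
move=> kn; rewrite /double_residues big_seq big1 // => t.
rewrite mem_doubles => /andP[/mem_row_seq[j' j'k ->]].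
case/mem_row_seq=> j jk e1; have /eqP := e1.
rewrite -(intrD _ _ 1) eqr_int => /eqP/esym eqx.
have [m mk zm] := adjacent_lower_LP i_range (tab_int b) (@tab_decr b) LP kn jk j'k eqx.
rewrite /reduced_residue e1 [X in _ * X / _]prod_row_seq.
by rewrite (row_prod_eq0 (j := m)) ?mulr0 ?mul0r // zm.
Qed.

Hypothesis T_out : forall L, ~ interlacing n i i' (entry L) -> T L = 0.

Definition raise_op (k : nat) : A := - row_op op k.+1 true.
Definition lower_op (k : nat) : A := row_op op k.+1 false.
Definition cartan_op (k : nat) : A := diag_op k.+1.

Lemma serre_relations_row_op :
  serre_relations (@op_br F K) n raise_op lower_op cartan_op.
Proof.
have brP := @op_lie_bracket F K.
have comm := row_op_comm_far op_wordE.
have serre := row_op_serre op_wordE i_range tab_int tab_decr T_out LP.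
have z0 (x : F) (u : A) (b1 b2 : bool) :
    (x *+ b1 - x *+ b2) *: u = (x *: u) *+ b1 - (x *: u) *+ b2.
  by rewrite scalerBl !scalerMnl.
split=> [a c _ _|a k an kn|a k an kn|k p kn pn|k p pn kp|k p pn kp|k kn|k kn|k kn|k kn];
  rewrite /raise_op /lower_op /cartan_op.
- exact: diag_br_diag.
- rewrite (brNr brP) diag_br_row // z0 scale1r !eqSS.
  by rewrite !mulNrn opprB opprK addrC.
- rewrite diag_br_row // z0 scaleN1r !eqSS.
  by rewrite !mulNrn opprK addrC.
- rewrite (brNl brP); have [<-|kp] := eqVneq k p; last first.
    by rewrite mulr0n (row_op_comm_raise_lower op_wordE) ?oppr0 //; lia.
  rewrite mulr1n; apply: funext => b; rewrite /op_br opprB.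
  rewrite row_commutator //.
  by rewrite double_residues_LP ?subr0 ?[(weight _ _ _ - _) *: _]scalerBl ?kn.
- by rewrite (brNl brP) (brNr brP) comm ?oppr0 //; lia.
- by rewrite comm //; lia.
- by rewrite !(brNl brP) !(brNr brP) serre ?oppr0 //; (try lia); left.
- by rewrite !(brNl brP) !(brNr brP) serre ?oppr0 //; (try lia); right.
- by rewrite serre //; (try lia); left.
- by rewrite serre //; (try lia); right.
Qed.

End Commutator.
End Generators.

Lemma elem_vec_raise (A : zmodType) (br : A -> A -> A) n e f h k :
  serre_relations br n e f h -> (k.+1 < n)%N -> elem_vec br e f h k k.+1 = e k.
Proof.
move=> S kn; rewrite elem_vecS // elem_vec_diag (serre_he S) //; last lia.
by rewrite eqxx ltn_eqF // subr0.
Qed.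

Lemma elem_vec_lower (A : zmodType) (br : A -> A -> A) n e f h k :
  lie_bracket br ->
  serre_relations br n e f h -> (k.+1 < n)%N -> elem_vec br e f h k.+1 k = f k.
Proof.
move=> brP S kn; rewrite -(elem_vec_op br e f h).
exact: elem_vec_raise (serre_relations_op brP S) kn.
Qed.

Section Sufficiency.
Variables (F : numFieldType) (n : nat) (K : choiceType).
Local Notation A := (K -> {malg F[K]}).

Lemma serre_gl_rep (e f h : nat -> A) : (0 < n)%N ->
  serre_relations (@op_br F K) n e f h ->
  exists2 rho : 'M[F]_n -> {malg F[K]} -> {malg F[K]}, gl_rep rho &
    forall b : K,
      [/\ forall a1 a2 : 'I_n, a2 = a1.+1 :> nat ->
            rho (delta_mx a1 a2) << b >> = e a1 b,
          forall a1 a2 : 'I_n, a2 = a1.+1 :> nat ->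
            rho (delta_mx a2 a1) << b >> = f a1 b
        & forall a : 'I_n, rho (delta_mx a a) << b >> = h a b].
Proof.
move=> n0 S; have brP := @op_lie_bracket F K.
have tf2 (x : A) : x *+ 2 = 0 -> x = 0.
  by move=> /eqP; rewrite -scaler_nat scaler_eq0 pnatr_eq0 /= => /eqP.
have rel := gl_relations_elem_vec brP S tf2 n0.
exists (fun X v => lin_ext (mx_op (elem_vec (@op_br F K) e f h) X) v).
  exact: gl_rep_mx_op rel.
move=> b; split=> [a1 a2 ea|a1 a2 ea|a]; rewrite lin_ext_basis mx_op_delta.
- by rewrite ea (elem_vec_raise S) // -ea.
- by rewrite ea (elem_vec_lower brP S) // -ea.
- by rewrite elem_vec_diag.
Qed.

End Sufficiency.

Section Basis.
Variables (F : numFieldType) (n : nat) (i i' : nat -> nat) (top : nat -> int).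
Hypothesis i_range : forall k : nat, (1 <= k < n)%N ->
  [/\ (i k <= k)%N, (1 <= i' k <= k.+1)%N & (i k < i' k)%N].
Hypothesis top_decr : forall j : nat, (1 <= j < n)%N -> top j.+1 < top j.
Local Notation B := (GG_basis n i i' top).

Lemma basis_interlacing (b : B) : interlacing n i i' (entry (val b)).
Proof. exact: ((GG_basisP i_range top_decr (val b)).1 (valP b)).2. Qed.

Lemma basis_decr (b : B) k : (1 <= k <= n)%N -> row_decr (entry (val b) k) k.
Proof.
have [tb ib] := (GG_basisP i_range top_decr (val b)).1 (valP b).
exact: (interlacing_rows_decr i_range top_decr tb ib).
Qed.

Lemma T_not_interlacing L :
  ~ interlacing n i i' (entry L) -> @T n i i' top F L = 0.
Proof.
move=> nint; apply: T_out; apply/negP => GG; apply: nint.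
exact: ((GG_basisP i_range top_decr L).1 GG).2.
Qed.

Lemma T_basis_cases L : @T n i i' top F L = 0 \/ exists b : B, L = val b.
Proof.
have [GG|nGG] := boolP (has_top_row top L && GG_condition i i' L).
  by right; exists (Sub L GG).
by left; exact: T_out.
Qed.

Lemma GT_raiseE k (b : B) :
  GT_raise i i' top F k (val b) = (- row_op (@step_op F n i i' top) k true) b.
Proof.
transitivity (- (row_op (@step_op F n i i' top) k true b)); last by [].
by rewrite /row_op sum_app.
Qed.

Lemma GT_lowerE k (b : B) : (1 <= k)%N ->
  GT_lower i i' top F k (val b) = row_op (@step_op F n i i' top) k false b.
Proof.
move=> k1; rewrite /row_op sum_app /GT_lower.
apply: eq_bigr => m _; rewrite /step_op /coef /partner /row_prod /=.
by rewrite (prednK k1).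
Qed.

Lemma GT_diagE k (b : B) : (1 <= k)%N ->
  GT_diag i i' top F k (val b) = weight F (val b) k *: << b >>.
Proof. by move=> k1; rewrite /GT_diag T_val /weight /row_sum (prednK k1). Qed.

Lemma GT_module_LP : (0 < n)%N -> LP_condition n i i' -> GT_module n i i' top F.
Proof.
move=> n0 LP.
have S := serre_relations_row_op
  (@op_word_step_op F n i i' top i_range top_decr) (@T_val F n i i' top) T_basis_cases
  i_range basis_interlacing basis_decr LP T_not_interlacing.
have [rho rhoP rhoE] := serre_gl_rep n0 S.
exists rho; first exact: rhoP.
move=> b; have [H1 H2 H3] := rhoE b; split=> [a1 a2 ea|a1 a2 ea|a].
- apply: (etrans (H1 _ _ ea)); exact: esym (GT_raiseE a1.+1 b).
- apply: (etrans (H2 _ _ ea)); exact: esym (@GT_lowerE a1.+1 b isT).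
- apply: (etrans (H3 a)); exact: esym (@GT_diagE a.+1 b isT).
Qed.

End Basis.

(** * Necessity of the LP-condition *)

Lemma linear_lin_ext (F : fieldType) (K : choiceType)
    (f : {malg F[K]} -> {malg F[K]}) v :
  linear f -> f v = lin_ext (fun b => f << b >>) v.
Proof.
move=> flin; have f0 : f 0 = 0.
  by have := flin (-1) 0 0; rewrite !scaleN1r oppr0 addr0 addNr.
rewrite {1}[v]monalgE /lin_ext.
elim/big_rec2: _ => [|b y1 y2 _ IH]; first exact: f0.
rewrite -IH -flin; congr (f (_ + _)); apply/malgP => c.
by rewrite mcoeffZ !mcoeffU mulr_natr.
Qed.

Lemma gl_rep_commutator (F : fieldType) (K : choiceType) n
    (rho : 'M[F]_n -> {malg F[K]} -> {malg F[K]}) (a1 a2 : 'I_n)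
    (e f h1 h2 : K -> {malg F[K]}) :
  gl_rep rho ->
  (forall b, rho (delta_mx a1 a2) << b >> = e b) ->
  (forall b, rho (delta_mx a2 a1) << b >> = f b) ->
  (forall b, rho (delta_mx a1 a1) << b >> = h1 b) ->
  (forall b, rho (delta_mx a2 a2) << b >> = h2 b) ->
  op_mul e f - op_mul f e = h1 - h2.
Proof.
move=> [rho_lin rho_linX rho_br] eE fE h1E h2E; apply: funext => b.
have rE v : rho (delta_mx a1 a2) v = lin_ext e v.
  by rewrite (linear_lin_ext v (rho_lin _)); congr (lin_ext _ v); apply: funext.
have rF v : rho (delta_mx a2 a1) v = lin_ext f v.
  by rewrite (linear_lin_ext v (rho_lin _)); congr (lin_ext _ v); apply: funext.
have lX v a X Y : rho (a *: X + Y) v = a *: rho X v + rho Y v by exact: rho_linX.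
have := rho_br (delta_mx a1 a2) (delta_mx a2 a1) << b >>.
rewrite !mul_delta_mx [delta_mx a1 a1 - _]addrC -[- delta_mx a2 a2]scaleN1r lX h1E h2E.
rewrite fE eE rE rF scaleN1r addrC => E; exact: esym E.
Qed.

Section Necessity.
Variables (F : numFieldType) (n : nat) (i i' : nat -> nat) (top : nat -> int).
Hypothesis i_range : forall k : nat, (1 <= k < n)%N ->
  [/\ (i k <= k)%N, (1 <= i' k <= k.+1)%N & (i k < i' k)%N].
Hypothesis top_decr : forall j : nat, (1 <= j < n)%N -> top j.+1 < top j.
Local Notation B := (GG_basis n i i' top).

Lemma GT_module_double_residues (b : B) k : (1 <= k < n)%N ->
  GT_module n i i' top F -> double_residues F (val b) k = 0.
Proof.
move=> kn [rho rhoP rhoE].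
have lt1 : (k.-1 < n)%N by lia.
have lt2 : (k < n)%N by lia.
pose a1 := Ordinal lt1; pose a2 := Ordinal lt2.
have ea : a2 = a1.+1 :> nat by rewrite /=; lia.
have k1 : (1 <= k)%N by lia.
have a1k : a1.+1 = k by rewrite /= prednK.
pose R e := row_op (@step_op F n i i' top) k e.
have eE (c : B) : rho (delta_mx a1 a2) << c >> = (- R true) c.
  have [H _ _] := rhoE c; apply: (etrans (H _ _ ea)).
  by rewrite a1k; exact: GT_raiseE.
have fE (c : B) : rho (delta_mx a2 a1) << c >> = R false c.
  have [_ H _] := rhoE c; apply: (etrans (H _ _ ea)).
  by rewrite a1k; exact: GT_lowerE.
have h1E (c : B) : rho (delta_mx a1 a1) << c >> = diag_op F val k c.
  have [_ _ H] := rhoE c; apply: (etrans (H a1)).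
  by rewrite a1k; exact: GT_diagE.
have h2E (c : B) : rho (delta_mx a2 a2) << c >> = diag_op F val k.+1 c.
  by have [_ _ H] := rhoE c; apply: (etrans (H a2)); exact: GT_diagE.
have := gl_rep_commutator rhoP eE fE h1E h2E.
exact: (@commutator_double_residues F n _ val (@T n i i' top F) _
  (@op_word_step_op F n i i' top i_range top_decr) (@T_val F n i i' top)
  i i' i_range (basis_interlacing i_range top_decr)
  (basis_decr i_range top_decr) k b kn).
Qed.

End Necessity.

Definition tableau_of (n : nat) (r : nat -> nat -> int) : tableau n :=
  [ffun p : {a : 'I_n & 'I_a.+1} => r (tag p).+1 (tagged p).+1].

Lemma entry_tableau_of n r a b : position n a b -> entry (tableau_of n r) a b = r a b.
Proof.
move=> /at_pos_exists[p abp]; rewrite (entry_at _ abp) ffunE.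
by case/andP: abp => /eqP ea /eqP eb; rewrite eb; congr (r _ b).
Qed.

(** * Construction of tableaux with a prescribed adjacent pair *)

Section Tower.
Variables (n : nat) (i i' : nat -> nat) (top : nat -> int).
Hypothesis i_range : forall k : nat, (1 <= k < n)%N ->
  [/\ (i k <= k)%N, (1 <= i' k <= k.+1)%N & (i k < i' k)%N].
Hypothesis top_decr : forall j : nat, (1 <= j < n)%N -> top j.+1 < top j.
Local Notation slot := (slot i i').

Section Choice.
Variable pick_entry : nat -> nat -> (nat -> int) -> int.

(** [tower d] is row n - d: rows are built downwards from the top, each entry chosen in its interval
    of the row above. *)
Fixpoint tower (d : nat) : nat -> int :=
  if d is d'.+1 then fun j => pick_entry (n - d) j (tower d') else top.

Definition tower_row (k : nat) : nat -> int := tower (n - k).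

Lemma tower_row_top : tower_row n = top.
Proof. by rewrite /tower_row subnn. Qed.

Lemma tower_rowS k j : (k < n)%N ->
  tower_row k j = pick_entry k j (tower_row k.+1).
Proof.
move=> kn; rewrite /tower_row; have -> : (n - k = (n - k.+1).+1)%N by lia.
by rewrite /= (_ : (n - (n - k.+1).+1 = k)%N) //; lia.
Qed.

Hypothesis pick_slot : forall k j y, (1 <= k < n)%N -> (1 <= j <= k)%N ->
  row_decr y k.+1 ->
  ((1 <= slot k j)%N -> pick_entry k j y <= y (slot k j)) /\
  ((slot k j < k.+1)%N -> y (slot k j).+1 < pick_entry k j y).

Lemma tower_row_decr k : (1 <= k <= n)%N -> row_decr (tower_row k) k.
Proof.
move=> kn; rewrite -(subKn (_ : k <= n)%N); last by case/andP: kn.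
have : (n - k < n)%N by lia.
elim: (n - k)%N => [_|d IH ltd]; first by rewrite subn0 tower_row_top.
have {IH} := IH (ltnW ltd); rewrite (_ : (n - d = (n - d.+1).+1)%N); last by lia.
have: (1 <= n - d.+1 < n)%N by lia.
move: (n - d.+1)%N => m mn dy j jm.
have sj : (slot m j < slot m j.+1)%N by apply: (slot_lt i_range); lia.
have sb : (slot m j.+1 <= m.+1)%N by apply: (slot_bound i_range); lia.
have jm1 : (1 <= j <= m)%N by lia.
have jm2 : (1 <= j.+1 <= m)%N by lia.
rewrite !tower_rowS; [|lia|lia].
have [_ lo] := pick_slot mn jm1 dy; have [up _] := pick_slot mn jm2 dy.
apply: le_lt_trans (up _) _; first lia.
apply: le_lt_trans (lo _); last lia.
by apply: (row_decr_le dy); lia.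
Qed.

Lemma tower_row_interlacing : interlacing n i i' tower_row.
Proof.
move=> k j s kn jk sk; have dy : row_decr (tower_row k.+1) k.+1.
  by apply: tower_row_decr; lia.
rewrite tower_rowS; last lia.
have [up lo] := pick_slot kn jk dy; have sb := slot_bound i_range kn jk.
have [le_s|lt_s] := leqP s (slot k j).
  apply: le_trans (up _) (row_decr_le dy _ le_s _); lia.
apply/negbTE; rewrite -ltNge; apply: le_lt_trans (lo _); last lia.
by apply: (row_decr_le dy); lia.
Qed.

Let L := tableau_of n tower_row.

Lemma tower_tableau_top j : (1 <= j <= n)%N -> entry L n j = top j.
Proof.
by move=> jn; rewrite entry_tableau_of ?tower_row_top // /position; lia.
Qed.

Lemma tower_tableau_entry k j : (1 <= j <= k)%N -> (k <= n)%N ->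
  entry L k j = tower_row k j.
Proof. by move=> jk kn; rewrite entry_tableau_of // /position; lia. Qed.

Lemma tower_tableau_interlacing : interlacing n i i' (entry L).
Proof.
move=> k j s kn jk sk.
by rewrite !tower_tableau_entry ?tower_row_interlacing //; lia.
Qed.

End Choice.

(* All entries are as large as possible, except that entry (k0, g) is as small *)
(* as possible, which makes it adjacent to entry (k0, g + 1); [tau] moves the  *)
(* leftmost entry of row k0 - 1 when that entry has no upper bound.            *)
Definition adjacent_pick (k0 g : nat) (tau : int) (k j : nat) (y : nat -> int) : int :=
  if (k == k0) && (j == g) then y (slot k j).+1 + 1
  else if slot k j == 0%N then y 1%N + 1 + (if k == k0.-1 then tau else 0)
  else y (slot k j).

Lemma adjacent_pick_slot k0 g tau k j y : (1 <= g < k0)%N -> 0 <= tau ->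
  (1 <= k < n)%N -> (1 <= j <= k)%N -> row_decr y k.+1 ->
  ((1 <= slot k j)%N -> adjacent_pick k0 g tau k j y <= y (slot k j)) /\
  ((slot k j < k.+1)%N -> y (slot k j).+1 < adjacent_pick k0 g tau k j y).
Proof.
move=> gk0 tau0 kn jk dy; rewrite /adjacent_pick.
have sb := slot_bound i_range kn jk.
case: ifP => [/andP[/eqP ek /eqP ej]|_].
  subst k0 g; split=> [s1|_]; last by lia.
  have sg : (slot k j < slot k j.+1)%N by apply: (slot_lt i_range); lia.
  have sb' : (slot k j.+1 <= k.+1)%N by apply: (slot_bound i_range); lia.
  have := dy (slot k j); lia.
case: eqP => [s0|/eqP s0]; split; rewrite ?s0 // => ?.
  by case: ifP; lia.
by apply: dy; lia.
Qed.

Section Adjacent.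
Variables (k g : nat).
Hypotheses (kn : (2 <= k < n)%N) (gk : (1 <= g < k)%N).
Hypotheses (gi : g != i k) (gi' : g != (i' k).-1).

Definition adjacent_tableau (tau : int) : tableau n :=
  tableau_of n (tower_row (adjacent_pick k g tau)).

Lemma adjacent_tableau_top tau j : (1 <= j <= n)%N ->
  entry (adjacent_tableau tau) n j = top j.
Proof. exact: tower_tableau_top. Qed.

Lemma adjacent_tableau_interlacing tau : 0 <= tau ->
  interlacing n i i' (entry (adjacent_tableau tau)).
Proof.
move=> tau0; apply: tower_tableau_interlacing => *.
exact: adjacent_pick_slot.
Qed.

Lemma adjacent_tableau_entry tau k1 j : (1 <= j <= k1)%N -> (k1 < n)%N ->
  entry (adjacent_tableau tau) k1 j =
  adjacent_pick k g tau k1 j (tower_row (adjacent_pick k g tau) k1.+1).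
Proof.
by move=> jk kn1; rewrite tower_tableau_entry ?tower_rowS //; lia.
Qed.

(** As g is neither i_k nor i'_k - 1, entries g and g + 1 have consecutive intervals; entry g + 1
    equals the separating entry of row k+1, and entry g exceeds it by 1. *)
Lemma adjacent_tableau_adjacent tau : 0 <= tau ->
  entry (adjacent_tableau tau) k g = entry (adjacent_tableau tau) k g.+1 + 1.
Proof.
move=> tau0; rewrite !adjacent_tableau_entry /adjacent_pick ?eqxx; try lia.
have -> : (g.+1 == g) = false by lia.
have -> : slot k g.+1 = (slot k g).+1 by apply: (slotS i_range); lia.
by rewrite andbF.
Qed.

Lemma adjacent_tableau_first tau : slot k.-1 1 = 0%N ->
  entry (adjacent_tableau tau) k.-1 1 = entry (adjacent_tableau tau) k 1 + 1 + tau.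
Proof.
move=> s0; rewrite adjacent_tableau_entry /adjacent_pick ?s0 ?eqxx; try lia.
rewrite (_ : (k.-1 == k) = false) /=; last lia.
by rewrite prednK ?tower_tableau_entry //; lia.
Qed.

Lemma adjacent_tableau_indep tau k1 j : (1 <= j <= k1)%N -> (k1 <= n)%N ->
  (k <= k1)%N || (k1 == k.-1) && (slot k1 j != 0%N) ->
  entry (adjacent_tableau tau) k1 j = entry (adjacent_tableau 0) k1 j.
Proof.
move=> jk1 k1n; rewrite !tower_tableau_entry //.
have up d : (k + d <= n)%N ->
    tower_row (adjacent_pick k g tau) (n - d) = tower_row (adjacent_pick k g 0) (n - d).
  elim: d => [|d IH] ltd; first by rewrite subn0 !tower_row_top.
  apply: funext => t; rewrite !tower_rowS; try lia.
  rewrite (_ : (n - d.+1).+1 = (n - d)%N); last lia.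
  rewrite IH /adjacent_pick; last lia.
  by rewrite (_ : (n - d.+1 == k.-1)%N = false) //; lia.
have upk m : (k <= m <= n)%N ->
    tower_row (adjacent_pick k g tau) m = tower_row (adjacent_pick k g 0) m.
  by move=> km; have := up (n - m)%N; rewrite subKn; [apply; lia|lia].
case/orP=> [kk1|/andP[/eqP-> s0]]; first by rewrite upk //; lia.
rewrite !tower_rowS; try lia.
rewrite upk /adjacent_pick; last lia.
by case: ifP => // _; rewrite (negbTE s0).
Qed.

End Adjacent.
End Tower.

Lemma reduced_residue_cons (F : fieldType) (X Y Z : seq F) z t :
  reduced_residue X Y (z :: Z) t = reduced_residue X Y Z t * (t + 1 - z).
Proof.
rewrite /reduced_residue big_cons; move: (_^-1) => b; ring.
Qed.

Lemma reduced_residue_neq0 (F : fieldType) (X Y Z : seq F) t :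
  t \in doubles X -> t + 1 \notin Z -> reduced_residue X Y Z t != 0.
Proof.
move=> tD tZ; rewrite /reduced_residue !mulf_neq0 ?invr_eq0 //.
- by apply: prod_neq0_seq => y _; apply: contraNneq => ->.
- by apply: prod_neq0_seq => z zZ _; apply: contraNneq tZ => <-.
- exact: prod_neq0_seq.
Qed.

(** * A nonzero defect when the LP-condition fails *)

Section AdjacentResidues.
Variables (F : numFieldType) (n : nat) (i i' : nat -> nat) (top : nat -> int).
Hypothesis i_range : forall k : nat, (1 <= k < n)%N ->
  [/\ (i k <= k)%N, (1 <= i' k <= k.+1)%N & (i k < i' k)%N].
Hypothesis top_decr : forall j : nat, (1 <= j < n)%N -> top j.+1 < top j.
Variables (k g g2 : nat).
Hypotheses (kn : (2 <= k < n)%N) (gk : (1 <= g < k)%N).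
Hypotheses (gi : g != i k) (gi' : g != (i' k).-1).
Hypothesis gaps : (g = i k.-1 /\ g2 = i' k.-1) \/ (g = i' k.-1 /\ g2 = i k.-1).

Local Notation L tau := (adjacent_tableau n i i' top k g tau).
Let l (a b : nat) : F := (entry (L 0) a b)%:~R.
Let X := row_seq F (L 0) k.
Let Y := row_seq F (L 0) k.+1.

Hypothesis residues0 : forall tau : int, 0 <= tau ->
  double_residues F (L tau) k = 0.

Let k1 : (1 <= k < n)%N. Proof. by move: kn; lia. Qed.
Let k2 : (1 <= k.-1 < n)%N. Proof. by move: kn; lia. Qed.

Let intL : interlacing n i i' (entry (L 0)).
Proof. exact: adjacent_tableau_interlacing. Qed.

Let decrL a : (1 <= a <= n)%N -> row_decr (entry (L 0) a) a.
Proof.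
apply: (interlacing_rows_decr i_range top_decr) => // j.
exact: adjacent_tableau_top.
Qed.

Let decrk : row_decr (entry (L 0) k) k.
Proof. by apply: decrL; move: kn; lia. Qed.

Let adj_g : l k g = l k g.+1 + 1.
Proof. by rewrite /l adjacent_tableau_adjacent // intrD. Qed.

Let row_seq_tau tau r : (k <= r <= n)%N -> row_seq F (L tau) r = row_seq F (L 0) r.
Proof.
move=> kr; apply/eq_in_map => j; rewrite mem_index_iota ltnS => jr.
congr (_%:~R); apply: adjacent_tableau_indep => //; lia.
Qed.

(** An entry of row k-1 equal to x_g = x_{g+1} + 1 would lie in interval g, which is empty. *)
Let gap_not_mem : l k g \notin row_seq F (L 0) k.-1.
Proof.
apply/negP => /mem_row_seq[m mk /eqP]; rewrite eqr_int => /eqP ez.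
have kE : k.-1.+1 = k by move: kn; lia.
have A : (entry (L 0) k.-1 m <= entry (L 0) k g) = (g <= slot i i' k.-1 m)%N.
  by have := @intL k.-1 m g k2 mk; rewrite kE; apply; move: gk; lia.
have C : (entry (L 0) k.-1 m <= entry (L 0) k g.+1) = (g.+1 <= slot i i' k.-1 m)%N.
  by have := @intL k.-1 m g.+1 k2 mk; rewrite kE; apply; move: gk; lia.
have := @adjacent_tableau_adjacent n i i' top i_range k g kn gk gi gi' 0 (lexx 0).
have [n1 n2] := slot_neq_gap i_range k2 mk.
have {}n1 : slot i i' k.-1 m != g by case: gaps => -[-> _].
rewrite -ez lexx in A C => e.
have F0 : (entry (L 0) k g <= entry (L 0) k g.+1) = false.
  by apply/negbTE; rewrite -ltNge e ltzD1.
by rewrite F0 in C; move: n1; rewrite eqn_leq -A leqNgt -C.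
Qed.

Let t1_double : l k g.+1 \in doubles X.
Proof.
rewrite mem_doubles -adj_g; apply/andP; split; apply/mem_row_seq.
  by exists g.+1 => //; move: gk; lia.
by exists g => //; move: gk; lia.
Qed.

Let residue_t1 : reduced_residue X Y (row_seq F (L 0) k.-1) (l k g.+1) != 0.
Proof. by apply: reduced_residue_neq0; rewrite -?adj_g. Qed.

Let double_cases t : t \in doubles X ->
  exists2 j, (1 <= j < k)%N & t = l k j.+1 /\ l k j = t + 1.
Proof.
rewrite mem_doubles => /andP[/mem_row_seq[j' j'k ->]].
case/mem_row_seq=> j jk e1.
have eqx : entry (L 0) k j = entry (L 0) k j' + 1.
  by apply/eqP; rewrite -(eqr_int F) intrD -e1.
have [_ ej _ _] := adjacent_upper i_range intL decrL k1 jk j'k eqx.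
by exists j; [move: jk j'k; rewrite ej; lia | rewrite -ej /l e1].
Qed.

(** A double pole x_{j+1} with j not an empty interval of row k-1 has residue 0 by
    [adjacent_lower]. *)
Let residue_other t : t \in doubles X -> t != l k g.+1 ->
  reduced_residue X Y (row_seq F (L 0) k.-1) t = 0 \/
  (1 <= g2 < k)%N /\ t = l k g2.+1.
Proof.
move=> /double_cases[j jk [-> ej]] tg.
have jg : j != g by apply: contraNneq tg => ->.
have [ejg2|jg2] := eqVneq j g2; first by right; rewrite -ejg2.
left; have n1 : j != i k.-1 by case: gaps => -[e1 e2]; rewrite -?e1 -?e2.
have n2 : j != i' k.-1 by case: gaps => -[e1 e2]; rewrite -?e1 -?e2.
have eqx : entry (L 0) k j = entry (L 0) k j.+1 + 1.
  by apply/eqP; rewrite -(eqr_int F) intrD -/(l k j) ej.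
have [m mk zm] := adjacent_lower i_range intL kn jk n1 n2 eqx.
rewrite /reduced_residue -ej [X in _ * X / _]prod_row_seq.
by rewrite (row_prod_eq0 (j := m)) ?mulr0 ?mul0r // zm.
Qed.

Lemma adjacent_residues_contra : False.
Proof.
have uD : uniq (doubles X) by apply: uniq_doubles; exact: row_seq_uniq.
(* If g2 cannot contribute, the residue at x_{g+1} is the only nonzero one. *)
have [g2k|g2k] := boolP (1 <= g2 < k)%N; last first.
  have := residues0 (lexx 0); rewrite /double_residues -/X -/Y.
  rewrite (bigD1_seq (l k g.+1)) //= big_seq_cond big1 ?addr0.
    by apply/eqP.
  move=> t /andP[tD tg].
  by have [//|[h _]] := residue_other tD tg; rewrite h in g2k.
(* Both empty intervals are now at least 1, so the first entry of row k-1 lies in interval 0 and has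
   no upper bound. *)
have s0 : slot i i' k.-1 1 = 0%N.
  rewrite /slot; case: ifP => //; case: gaps => -[e1 e2]; rewrite -?e1 -?e2.
    by move: gk; lia.
  by move: g2k; lia.
pose Z' : seq F := [seq l k.-1 j | j <- index_iota 2 k].
have rowZ tau : row_seq F (L tau) k.-1 = (l k 1 + 1 + tau%:~R) :: Z'.
  have kE : k.-1.+1 = k by move: kn; lia.
  rewrite /row_seq kE (_ : index_iota 1 k = 1%N :: index_iota 2 k); last first.
    by rewrite /index_iota; have -> : (k - 1 = (k - 2).+1)%N by move: kn; lia.
  have xE : entry (L tau) k 1 = entry (L 0) k 1.
    by apply: adjacent_tableau_indep => //; move: kn; lia.
  rewrite map_cons adjacent_tableau_first // xE !intrD.
  congr (_ :: _); apply/eq_in_map => j; rewrite mem_index_iota => jk.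
  congr (_%:~R); apply: adjacent_tableau_indep => //; try lia.
  rewrite eqxx /= (_ : slot i i' k.-1 j != 0%N) ?orbT //.
  have := @slot_lt n i i' i_range k.-1 1 j k2; lia.
pose R t := reduced_residue X Y Z' t.
have sumR tau : 0 <= tau -> \sum_(t <- doubles X) R t * (t - l k 1 - tau%:~R) = 0.
  move=> tau0; rewrite -[RHS](residues0 tau0) /double_residues.
  have eX : row_seq F (L tau) k = X by apply: row_seq_tau; move: kn; lia.
  have eY : row_seq F (L tau) k.+1 = Y by apply: row_seq_tau; move: kn; lia.
  rewrite eX eY rowZ.
  have term t : reduced_residue X Y (l k 1 + 1 + tau%:~R :: Z') t =
      R t * (t - l k 1 - tau%:~R).
    by rewrite reduced_residue_cons; congr (_ * _); ring.
  by under [RHS]eq_bigr do rewrite term.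
pose t2 := l k g2.+1.
(* The sum in [sumR] is affine in tau and vanishes at 0 and 1, hence identically; its formal value
   at tau = t2 - x_1 removes the contribution of t2. *)
have sum2 : \sum_(t <- doubles X) R t * (t - t2) = 0.
  have -> : \sum_(t <- doubles X) R t * (t - t2) =
      \sum_(t <- doubles X) R t * (t - l k 1 - 0%:~R) + (l k 1 - t2) *
      (\sum_(t <- doubles X) R t * (t - l k 1 - 0%:~R)
       - \sum_(t <- doubles X) R t * (t - l k 1 - 1%:~R)).
    rewrite -sumrB mulr_sumr -big_split; apply: eq_bigr => t _ /=.
    by rewrite mulr0z mulr1z; ring.
  by rewrite !sumR // subrr mulr0 addr0.
have other t : t \in doubles X -> t != l k g.+1 -> R t * (t - t2) = 0.
  move=> tD tg; have [r0|[_ ->]] := residue_other tD tg; last by rewrite subrr mulr0.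
  have [j jk [et _]] := double_cases tD.
  move: r0; rewrite rowZ reduced_residue_cons -/(R t) => /eqP; rewrite mulf_eq0.
  case/orP=> [/eqP->|]; first by rewrite mul0r.
  (* The remaining possibility t = x_1 is excluded, because t = x_{j+1} with j >= 1. *)
  rewrite addr0 opprD addrACA subrr addr0 subr_eq0 et.
  by rewrite (row_entry_inj F decrk) //; lia.
move: sum2; rewrite (bigD1_seq (l k g.+1)) //= big_seq_cond big1 ?addr0; last first.
  by move=> t /andP[tD tg]; exact: other.
move/eqP; rewrite mulf_eq0 => /orP[/eqP R0|].
  by move: residue_t1; rewrite rowZ reduced_residue_cons -/(R _) R0 mul0r eqxx.
rewrite subr_eq0 (row_entry_inj F decrk); try lia.
(* The two poles coincide only if g = g2, contrary to i_{k-1} < i'_{k-1}. *)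
move=> /eqP[eg]; have [_ _] := i_range k2.
by case: gaps => -[<- <-]; rewrite eg ltnn.
Qed.

End AdjacentResidues.

Section LPNecessary.
Variables (F : numFieldType) (n : nat) (i i' : nat -> nat) (top : nat -> int).
Hypothesis i_range : forall k : nat, (1 <= k < n)%N ->
  [/\ (i k <= k)%N, (1 <= i' k <= k.+1)%N & (i k < i' k)%N].
Hypothesis top_decr : forall j : nat, (1 <= j < n)%N -> top j.+1 < top j.

Lemma GT_module_gap k g g2 : GT_module n i i' top F -> (2 <= k < n)%N ->
  (g = i k.-1 /\ g2 = i' k.-1) \/ (g = i' k.-1 /\ g2 = i k.-1) ->
  g \in [:: 0%N; i k; (i' k).-1; k].
Proof.
move=> GT kn gaps; apply/negPn/negP; rewrite !inE !negb_or => /and4P[g0 gi gi' gk].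
have k2 : (1 <= k.-1 < n)%N by lia.
have gk' : (1 <= g < k)%N by have [? ? ?] := i_range k2; case: gaps => -[? _]; lia.
apply: (@adjacent_residues_contra F n i i' top i_range top_decr k g g2) => //.
move=> tau tau0.
have GG : has_top_row top (adjacent_tableau n i i' top k g tau)
    && GG_condition i i' (adjacent_tableau n i i' top k g tau).
  apply/(GG_basisP i_range top_decr); split=> [j|].
    exact: adjacent_tableau_top.
  exact: adjacent_tableau_interlacing.
pose b : GG_basis n i i' top := Sub (adjacent_tableau n i i' top k g tau) GG.
by apply: (GT_module_double_residues i_range top_decr b) GT; lia.
Qed.

Lemma GT_module_iff_LP : (0 < n)%N ->
  GT_module n i i' top F <-> LP_condition n i i'.
Proof.
move=> n0; split=> [GT k kn|]; last exact: GT_module_LP.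
split; first by apply: GT_module_gap GT kn _; left.
by apply: GT_module_gap GT kn _; right.
Qed.

End LPNecessary.

Theorem theoremI (R : realType) (n : nat) (i i' : nat -> nat) (top : nat -> int)
    (n_ge2 : (2 <= n)%N)
    (i_range : forall k : nat, (1 <= k < n)%N ->
       [/\ (i k <= k)%N, (1 <= i' k <= k.+1)%N & (i k < i' k)%N])
    (top_decr : forall j : nat, (1 <= j < n)%N -> (top j.+1 < top j)%R) :
  GT_module n i i' top (complex R) <-> LP_condition n i i'.
Proof. exact: GT_module_iff_LP i_range top_decr (ltnW n_ge2). Qed.
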